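(* Let $m\in\mathbb Z_+$, $n\in\mathbb N$, $\ell\ge2$, and let $V=\mathbb C^{m|n}\cong L(\mathfrak{gl}(m|n),\epsilon_1)$ be the natural module of $\mathfrak{gl}(m|n)$. For each $(z_1,\dots,z_\ell)\in\mathbb C^\ell$ with pairwise distinct coordinates, the action of the algebra generated by the quadratic Gaudin Hamiltonians $\bar H^1,\dots,\bar H^\ell$ of $\mathfrak{gl}(m|n)$ on the singular space $(V^{\otimes\ell})^{\rm sing}$ has a cyclic vector.
   Context: Everything is over $\mathbb C$. Let $\bar I=\{1,\dots,m\}\cup\{\frac12,\frac32,\dots,n-\frac12\}$, ordered with the integers first and then the half-odd-integers, each increasing. $\mathfrak{gl}(m|n)$ has basis the matrix units $E_{r,s}$ ($r,s\in\bar I$) on the superspace $\mathbb C^{m|n}$ with basis $v_r$, $r\in\bar I$, where $v_r$ is even for $r\in\mathbb Z$ and odd otherwise; $\epsilon_r$ is the dual basis to $E_{r,r}$. For a module $N$, $N^{\rm sing}=\{v\in N:E_{r,s}v=0\text{ for all }r<s\}$ (in the given order). The quadratic Gaudin Hamiltonians are $$\bar H^i=\sum_{j\ne i}\frac{1}{z_i-z_j}\sum_{r,s\in\bar I}(-1)^{2s}E^{(i)}_{r,s}E^{(j)}_{s,r},\qquad i=1,\dots,\ell,$$ where $E^{(i)}$ denotes the action on the $i$-th tensor factor (with the super sign rule). A cyclic vector is a vector $w$ such that applying the (unital) algebra to $w$ yields the whole space. *)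

(* Defs.v *)
From HB Require Import structures.
From mathcomp Require Import all_boot all_order all_algebra.
From mathcomp Require Import classical_sets reals.
From mathcomp Require Import complex.

Set Implicit Arguments.
Unset Strict Implicit.
Unset Printing Implicit Defensive.

Import GRing.Theory.
Local Open Scope ring_scope.

(* The index set Ibar = {1, ..., m} u {1/2, ..., n - 1/2} is encoded as
   'I_(m + n): the ordinal r < m stands for the integer r + 1 and the ordinal
   m + k stands for the half-odd-integer k + 1/2.  The order of Ibar (integers
   first, each part increasing) is then the order of the ordinals.  The value
   [par r] is the parity of v_r; it is also the residue of 2r modulo 2. *)
Definition par (m n : nat) (r : 'I_(m + n)) : bool := (m <= r)%N.

(* A word a indexes the pure tensor v_(a 0) (x) ... (x) v_(a (l-1)), and the
   tensor power V^{(x) l} of V = K^{m|n} is the space with basis the words. *)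
Notation word m n l := {ffun 'I_l -> 'I_(m + n)}.
Notation tpow K m n l := {ffun word m n l -> K^o}.

Definition tbasis (K : fieldType) (m n l : nat) (a : word m n l) :
  tpow K m n l := [ffun b => (b == a)%:R].

Definition subst_word (m n l : nat) (a : word m n l) (i : 'I_l)
  (r : 'I_(m + n)) : word m n l := [ffun k => if k == i then r else a k].

Definition lin_ext (K : fieldType) (m n l : nat)
  (f : word m n l -> tpow K m n l) (v : tpow K m n l) : tpow K m n l :=
  \sum_a (v a : K) *: f a.

Lemma lin_ext_is_linear (K : fieldType) (m n l : nat)
  (f : word m n l -> tpow K m n l) : linear (lin_ext f).
Proof.
move=> c u v; rewrite /lin_ext scaler_sumr -big_split /=.
by apply: eq_bigr => a _; rewrite !ffunE scalerDl scalerA.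
Qed.

Lemma lin_ext_basis (K : fieldType) (m n l : nat)
  (f : word m n l -> tpow K m n l) (a : word m n l) :
  lin_ext f (tbasis K a) = f a.
Proof.
rewrite /lin_ext (bigD1 a) //= big1 => [|b ba]; last first.
  by rewrite ffunE (negbTE ba) scale0r.
by rewrite ffunE eqxx scale1r addr0.
Qed.

HB.instance Definition _ (K : fieldType) (m n l : nat)
  (f : word m n l -> tpow K m n l) :=
  GRing.isLinear.Build K (tpow K m n l) (tpow K m n l) _ (lin_ext f)
    (lin_ext_is_linear f).

(* For a homogeneous X in gl(m|n) of parity p, the operator X^(i) with the
   super sign rule: moving X past the first i factors v_(a k) gives the sign
   (-1)^(p * sum_(k < i) par (a k)), and X v_q = sum_r X_{r,q} v_r. *)
Definition factor_act (K : fieldType) (m n l : nat) (i : 'I_l) (p : bool)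
  (X : 'M[K]_(m + n)) : 'End(tpow K m n l) :=
  linfun (lin_ext (fun a =>
    (-1) ^+ (p * \sum_(k < l | (k < i)%N) par (a k))%N *:
      \sum_r X r (a i) *: tbasis K (subst_word a i r))).

Definition Efac (K : fieldType) (m n l : nat) (i : 'I_l)
  (r s : 'I_(m + n)) : 'End(tpow K m n l) :=
  factor_act i (par r (+) par s) (delta_mx r s).

Definition Etens (K : fieldType) (m n l : nat) (r s : 'I_(m + n)) :
  'End(tpow K m n l) := \sum_(i < l) Efac K i r s.

Definition sing_space (K : fieldType) (m n l : nat) : {vspace tpow K m n l} :=
  (\bigcap_(r < m + n) \bigcap_(s < m + n | (r < s)%N)
    lker (Etens K l r s))%VS.

Definition gaudin (K : fieldType) (m n l : nat) (z : 'I_l -> K) (i : 'I_l) :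
  'End(tpow K m n l) :=
  \sum_(j < l | j != i) (z i - z j)^-1 *:
    \sum_(r < m + n) \sum_(s < m + n)
      (-1) ^+ par s *: (Efac K i r s \o Efac K j s r)%VF.

Definition unital_subalg (K : fieldType) (T : vectType K)
  (A : set 'End(T)) : Prop :=
  [/\ A \1%VF,
      forall (c : K) f g, A f -> A g -> A (c *: f + g) &
      forall f g, A f -> A g -> A (f \o g)%VF].

Definition gaudin_alg (K : fieldType) (m n l : nat) (z : 'I_l -> K) :
  set 'End(tpow K m n l) :=
  smallest (@unital_subalg K _) (range (gaudin m n z)).

Arguments gaudin_alg {K} m n {l} z _.

(* The equality of sets makes A w contained in U as well as containing it. *)
Definition cyclic_vector (K : fieldType) (T : vectType K)
  (A : set 'End(T)) (U : {vspace T}) (w : T) : Prop :=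
  w \in U /\ [set (f : 'End(T)) w | f in A]%classic = [set v | v \in U]%classic.

Lemma Efac_basis (K : fieldType) (m n l : nat) (i : 'I_l)
  (r s : 'I_(m + n)) (a : word m n l) :
  Efac K i r s (tbasis K a) =
  if a i == s then
    (-1) ^+ ((par r (+) par s) * \sum_(k < l | (k < i)%N) par (a k))%N *:
      tbasis K (subst_word a i r)
  else 0.
Proof.
rewrite /Efac /factor_act lfunE /= lin_ext_basis.
set c := (-1) ^+ _; rewrite (bigD1 r) //= big1 => [|q qr]; last first.
  by rewrite mxE (negbTE qr) scale0r.
rewrite mxE eqxx /= addr0; case: (a i == s); first by rewrite scale1r.
by rewrite scale0r scaler0.
Qed.

(* Main.v *)
Require Import Defs.
From HB Require Import structures.
From mathcomp Require Import all_boot all_order all_fingroup all_algebra.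
From mathcomp Require Import classical_sets reals.
From mathcomp Require Import complex ring.

(* The Gaudin Hamiltonian H_i is the sum over j <> i of P_ij / (z_i - z_j), where
   P_ij is the super flip, so everything takes place in a signed permutation
   representation of S_l on the tensor power.  The adjoint of H_i for the
   standard Hermitian form is the Hamiltonian with conjugate parameters; a
   vector w of the singular space is therefore cyclic as soon as it is not
   orthogonal to any joint eigenvector of the conjugate Hamiltonians, and such
   a w exists once all joint eigenspaces in the singular space are lines.

   For this, let v be a joint eigenvector with eigenvalues c.  The functions
   w |-> xi (w v) on S_l are killed by the operators y_k of a representation of
   the rational Cherednik algebra at t = 0 on the functions on S_l, in which x_k
   acts through z and y_k through c.  In a finite dimensional representation
   every w <> 1 is a commutator of y_i with x_j w', where w' fixes i, so it has
   trace 0 and the dimension is a multiple of l!; hence this representation of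
   dimension l! is simple, and so is its associated graded for the filtration by
   degree in x generated by any S_l-stable space U killed by the y_k.  It
   follows that U contains every vector killed by the y_k.  Thus two joint
   eigenvectors v1, v2 with the same eigenvalues have the same matrix
   coefficients, so some operator commuting with S_l maps v1 to v2.  Such an
   operator is a combination of symmetrized products of matrix units, which
   act on a singular weight vector as scalars modulo the orthogonal complement
   of the singular space; therefore v2 is a multiple of v1. *)

Set Implicit Arguments.
Unset Strict Implicit.
Unset Printing Implicit Defensive.

Import GRing.Theory Num.Theory.
Local Open Scope ring_scope.

(** * Traces on subspaces and the Cherednik algebra at t = 0 *)

Section TraceOn.
Variables (K : fieldType) (V : vectType K).
Implicit Types (W : {vspace V}) (f g : 'End(V)).

(** Row i holds the coordinates of the image of the i-th basis vector, so matrices multiply in the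
    order in which the maps are applied. The matrix represents f only when f maps W into W'. *)
Definition mx_on W W' f : 'M[K]_(\dim W, \dim W') :=
  \matrix_(i, j) coord (vbasis W') j (f (vbasis W)`_i).

Definition trace_on W f : K := \tr (mx_on W W f).

Lemma mx_on_comp W W' W'' f g : (f @: W <= W')%VS ->
  mx_on W W'' (g \o f)%VF = mx_on W W' f *m mx_on W' W'' g.
Proof.
move=> fW; apply/matrixP => i j; rewrite !mxE comp_lfunE.
have fb : f (vbasis W)`_i \in W'.
  by apply: (subvP fW); apply: memv_img; apply/vbasis_mem/mem_nth; rewrite size_tuple.
rewrite {1}(coord_vbasis fb) linear_sum linear_sum.
by apply: eq_bigr => k _; rewrite !linearZ !mxE.
Qed.

(** Two different spaces are allowed, so that a trace can be moved along a filtration. *)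
Lemma trace_on_cyclic W W' f g : (f @: W <= W')%VS -> (g @: W' <= W)%VS ->
  trace_on W (g \o f)%VF = trace_on W' (f \o g)%VF.
Proof.
move=> fW gW; rewrite /trace_on (mx_on_comp _ _ fW) (mx_on_comp _ _ gW).
exact: mxtrace_mulC.
Qed.

Lemma eq_trace_on W f g : {in W, f =1 g} -> trace_on W f = trace_on W g.
Proof.
move=> fg; congr (\tr _); apply/matrixP => i j; rewrite !mxE fg //.
by apply/vbasis_mem/mem_nth; rewrite size_tuple.
Qed.

Lemma trace_on_is_linear W : linear (trace_on W : 'End(V) -> K^o).
Proof.
move=> c f g; rewrite /trace_on -linearZ -linearD; congr (\tr _).
by apply/matrixP => i j; rewrite !mxE add_lfunE scale_lfunE linearP.
Qed.

HB.instance Definition _ W := GRing.isLinear.Build K 'End(V) K^o _ (trace_on W)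
  (trace_on_is_linear W).

Lemma trace_on1 W : trace_on W \1%VF = (\dim W)%:R.
Proof.
rewrite -mxtrace1; congr (\tr _); apply/matrixP => i j.
by rewrite !mxE id_lfunE coord_free ?(basis_free (vbasisP W)).
Qed.

Lemma trace_on0 f : trace_on 0 f = 0.
Proof.
rewrite /trace_on /mxtrace big1 // => i _.
by have := ltn_ord i; rewrite [X in (_ < X)%N]dimv0.
Qed.

(** By cyclicity between W and its image, where f is the identity, the trace is that of this
    identity. *)
Lemma trace_on_idempotent W f : (f @: W <= W)%VS -> (f \o f)%VF = f ->
  trace_on W f = (\dim (f @: W))%:R.
Proof.
move=> fW ff; rewrite -{1}(comp_lfun1l f) (@trace_on_cyclic W (f @: W)%VS) //; last first.
  by rewrite lim1g.
rewrite -trace_on1; apply: eq_trace_on => _ /memv_imgP[v _ ->].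
by rewrite comp_lfun1r id_lfunE -comp_lfunE ff.
Qed.

End TraceOn.

(** * Trace identities and simplicity in dimension n! *)

Section Cherednik.
Variables (K : numFieldType) (n : nat) (E : vectType K).
Variables (L : 'S_n -> 'End(E)) (x y : 'I_n -> 'End(E)).
Hypothesis dimE : \dim {:E} = n`!.
Hypothesis L1 : L 1%g = \1%VF.
Hypothesis LM : forall g h u, L (g * h)%g u = L h (L g u).
Hypothesis Lx : forall g k u, L g (x k u) = x (g k) (L g u).
Hypothesis Ly : forall g k u, L g (y k u) = y (g k) (L g u).
Hypothesis xy_comm : forall i j u, i != j ->
  y i (x j u) = x j (y i u) - L (tperm i j) u.
Hypothesis xx_comm : forall i u,
  y i (x i u) = x i (y i u) + \sum_(k | k != i) L (tperm i k) u.

Definition sym_stable (W : {vspace E}) := forall g, (L g @: W <= W)%VS.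

Lemma sym_stableP W : sym_stable W <-> forall g u, u \in W -> L g u \in W.
Proof.
split=> [sW g u uW|sW g]; first by apply: (subvP (sW g)); apply: memv_img.
by apply/subvP => _ /memv_imgP[u uW ->]; apply: sW.
Qed.

(* For w <> 1, pick i with w i = j <> i and put w' = w (i j): w' fixes i, so
   that L w = L (i j) L w' is the commutator of x_j and y_i L w'. *)
Lemma nontrivial_permE w : w != 1%g ->
  exists i j, exists2 w' : 'S_n, w' i = i &
    L w = ((x j \o (y i \o L w')) - (y i \o (x j \o L w')))%VF.
Proof.
move=> w1; have [i wi]: exists i, w i != i.
  apply/existsP; apply: contraNT w1; rewrite negb_exists => /forallP wi.
  by apply/eqP/permP => i; rewrite perm1; apply/eqP; move: (wi i); rewrite negbK.
exists i, (w i), (w * tperm i (w i))%g; first by rewrite permM tpermR.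
apply/lfunP => u; rewrite add_lfunE opp_lfunE !comp_lfunE.
rewrite xy_comm 1?eq_sym // opprB addrC subrK -LM.
by rewrite -mulgA tperm2 mulg1.
Qed.

(** Cyclicity brings y_i to the right of [L w], and it passes back to the left because w fixes i. *)
Lemma trace_on_yxL W W' (w : 'S_n) i j : w i = i ->
  (L w @: W <= W)%VS -> (x j @: W <= W')%VS -> (y i @: W' <= W)%VS ->
  trace_on W (y i \o (x j \o L w))%VF = trace_on W' (x j \o (y i \o L w))%VF.
Proof.
move=> wi sW xW yW; rewrite (trace_on_cyclic _ yW); last first.
  by rewrite limg_comp; apply: subv_trans xW; apply: limgS.
by apply: eq_trace_on => u _; rewrite !comp_lfunE Ly wi.
Qed.

(* The sum telescopes: the trace of y_i x_j w' on C t is that of x_j y_i w' on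
   C t.+1. *)
Lemma trace_chain w (i j : 'I_n) (w' : 'S_n) (C : nat -> {vspace E}) D :
    w' i = i -> L w = ((x j \o (y i \o L w')) - (y i \o (x j \o L w')))%VF ->
    C 0%N = 0%VS -> (forall t, sym_stable (C t)) ->
    (forall t k, (x k @: C t <= C t.+1)%VS) ->
    (forall t k, (y k @: C t.+1 <= C t)%VS) ->
  \sum_(t < D) trace_on (C t) (L w) =
  - trace_on (C D) (x j \o (y i \o L w'))%VF.
Proof.
move=> w'i Lw C0 sC xC yC; elim: D => [|D IH].
  by rewrite big_ord0 C0 trace_on0 oppr0.
rewrite big_ord_recr /= IH Lw linearB /=.
by rewrite (trace_on_yxL w'i (sC D w') (xC D j) (yC D i)) addrA addNr add0r.
Qed.

Definition sym_sum : 'End(E) := \sum_w L w.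
Definition sym_proj : 'End(E) := (n`!%:R)^-1 *: sym_sum.

Lemma fact_neq0 : (n`!%:R : K) != 0.
Proof. by rewrite pnatr_eq0 -lt0n fact_gt0. Qed.

Lemma sym_proj_idem : (sym_proj \o sym_proj)%VF = sym_proj.
Proof.
have LS g u : L g (sym_proj u) = sym_proj u.
  rewrite /sym_proj scale_lfunE linearZ /sym_sum !sum_lfunE linear_sum.
  rewrite [in RHS](reindex_inj (mulIg g)) /=; congr (_ *: _).
  by apply: eq_bigr => h _; rewrite LM.
apply/lfunP => u; rewrite comp_lfunE; set v := sym_proj u.
rewrite /sym_proj scale_lfunE sum_lfunE (eq_bigr (fun=> v)) => [|g _].
  by rewrite sumr_const card_Sn -scaler_nat scalerA mulVf ?fact_neq0 ?scale1r.
exact: LS.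
Qed.

Lemma sym_proj_stable W : sym_stable W -> (sym_proj @: W <= W)%VS.
Proof.
move/sym_stableP => sW; apply/subvP => _ /memv_imgP[u uW ->].
rewrite /sym_proj scale_lfunE rpredZ // sum_lfunE rpred_sum // => g _.
exact: sW.
Qed.

(** [sym_proj] projects onto the invariants, and the trace of a projector is its rank. *)
Lemma trace_sym_sum W : sym_stable W ->
  trace_on W sym_sum = (n`! * \dim (sym_proj @: W))%:R.
Proof.
move=> sW; rewrite natrM -trace_on_idempotent ?sym_proj_idem ?sym_proj_stable //.
by rewrite linearZ /= /GRing.scale /= mulrA mulfV ?fact_neq0 ?mul1r.
Qed.

Lemma trace_sym_sumE W : trace_on W sym_sum =
  (\dim W)%:R + \sum_(w | w != 1%g) trace_on W (L w).
Proof. by rewrite linear_sum (bigD1 1%g) //= L1 trace_on1. Qed.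

(** Every w <> 1 has trace 0 on W, so dim W is n! times the dimension of the invariants in W; being
    nonzero, W has at least the dimension n! of the whole space. *)
Lemma cherednik_simple W : sym_stable W -> W != 0%VS ->
    (forall k, (x k @: W <= W)%VS) -> (forall k, (y k @: W <= W)%VS) ->
  W = fullv.
Proof.
move=> sW W0 xW yW; have := trace_sym_sum sW.
rewrite trace_sym_sumE big1 ?addr0 => [|w /nontrivial_permE[i [j [w' w'i ->]]]].
  move/eqP; rewrite eqr_nat => /eqP dW.
  apply/eqP; rewrite eqEdim subvf dimE dW leq_pmulr // lt0n.
  by apply: contraNneq W0 => d0; rewrite -dimv_eq0 dW d0 muln0.
by rewrite linearB /= (trace_on_yxL w'i (sW w') (xW j) (yW i)) subrr.
Qed.

(** * The filtration by degree in x and its associated graded module *)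

Section Killed.
Variable U : {vspace E}.
Hypothesis sU : sym_stable U.
Hypothesis U0 : U != 0%VS.
Hypothesis yU : forall k u, u \in U -> y k u = 0.

(** Spanned by the images of U under words of length less than t in the x_k; the shift makes
    [xfil 0] zero and [xfil 1] equal to U. *)
Fixpoint xfil t : {vspace E} :=
  if t is t'.+1 then (U + xfil t' + \sum_(k < n) x k @: xfil t')%VS else 0%VS.

Lemma xfilS t : (xfil t <= xfil t.+1)%VS.
Proof. by rewrite /= [(U + _)%VS]addvC -addvA addvSl. Qed.

Lemma xfil_x t k : (x k @: xfil t <= xfil t.+1)%VS.
Proof. by apply: (subv_trans _ (addvSr _ _)); apply: (sumv_sup k). Qed.

Lemma xfil_U t : (U <= xfil t.+1)%VS.
Proof. by rewrite /= -addvA addvSl. Qed.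

Lemma xfil_ind t (W : {vspace E}) : (U <= W)%VS -> (xfil t <= W)%VS ->
  (forall k u, u \in xfil t -> x k u \in W) -> (xfil t.+1 <= W)%VS.
Proof.
move=> UW tW xW; rewrite /= !subv_add UW tW /=; apply/subv_sumP => k _.
by apply/subvP => _ /memv_imgP[u ut ->]; apply: xW.
Qed.

Lemma xfil_stable t : sym_stable (xfil t).
Proof.
elim: t => [|t IH] g; first by rewrite limg0.
apply/subvP => _ /memv_imgP[u ut ->]; move: u ut.
suff: (xfil t.+1 <= L g @^-1: xfil t.+1)%VS.
  by move/subvP => H u /H; rewrite -memv_preim.
apply: xfil_ind => [||k u ut]; try (apply/subvP => u ut); rewrite -memv_preim.
- by apply: (subvP (xfil_U t)); move/sym_stableP: sU; apply.
- by apply: (subvP (xfilS t)); move/sym_stableP: IH; apply.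
- rewrite Lx; apply: (subvP (xfil_x t (g k))); apply: memv_img.
  by move/sym_stableP: IH; apply.
Qed.

Lemma commutator_mem W i j u : sym_stable W -> u \in W ->
  y i (x j u) - x j (y i u) \in W.
Proof.
move/sym_stableP => sW uW; have [->|ij] := eqVneq j i.
  by rewrite xx_comm addrAC subrr add0r rpred_sum // => k _; apply: sW.
by rewrite xy_comm 1?eq_sym // addrAC subrr add0r rpredN sW.
Qed.

(** Each y_k kills U, and moving it past x_j leaves x_j y_k u, of lower degree by induction, plus a
    combination of group elements applied to u. *)
Lemma xfil_y t k : (y k @: xfil t.+1 <= xfil t)%VS.
Proof.
apply/subvP => _ /memv_imgP[u ut ->]; move: u ut.
suff: (xfil t.+1 <= y k @^-1: xfil t)%VS.
  by move/subvP => H u /H; rewrite -memv_preim.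
elim: t => [|t IH].
  apply: xfil_ind => [||j u]; last by rewrite memv0 => /eqP->; rewrite linear0 mem0v.
    by apply/subvP => u uU; rewrite -memv_preim yU ?mem0v.
  exact: sub0v.
apply: xfil_ind => [||j u ut].
- by apply/subvP => u uU; rewrite -memv_preim yU ?mem0v.
- apply: (subv_trans IH); apply/subvP => u; rewrite -!memv_preim => ut.
  exact: (subvP (xfilS t)).
- rewrite -memv_preim -[y k _](subrK (x j (y k u))) rpredD //.
    exact: (commutator_mem _ _ (@xfil_stable t.+1)).
  apply: (subvP (xfil_x t j)); apply: memv_img.
  by move/subvP: IH => /(_ u ut); rewrite -memv_preim.
Qed.

(** The dimension of E serves as a number of steps after which the filtration must be exhausted:
    where it stops growing it is nonzero and stable under all operators, hence full by
    [cherednik_simple]. *)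
Let D := n`!.

Lemma xfil_full : xfil D = fullv.
Proof.
suff H t : xfil t = fullv \/ (t <= \dim (xfil t))%N.
  have [//|dD] := H D; apply/eqP; rewrite eqEdim subvf dimE //.
elim: t => [|t [IH|IH]]; first by right.
  by left; apply/eqP; rewrite eqEsubv subvf -{1}IH xfilS.
have [e|ne] := eqVneq (xfil t) (xfil t.+1).
  left; rewrite -e; apply: cherednik_simple => //.
  - exact: xfil_stable.
  - by apply: contraNneq U0 => t0; rewrite -subv0 -t0 e xfil_U.
  - by move=> k; rewrite [X in (_ <= X)%VS]e xfil_x.
  - by move=> k; rewrite {1}e xfil_y.
right; apply: (leq_ltn_trans IH); rewrite ltn_neqAle dimvS ?xfilS // andbT.
by apply: contraNneq ne => dd; rewrite eqEdim xfilS dd leqnn.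
Qed.

(* [rad t] lies between [xfil t] and [xfil t.+1], and [rad t] modulo [xfil t] is
   the degree t part of the largest graded submodule, without degree 0 part, of
   the graded module associated with the filtration. *)
Fixpoint rad t : {vspace E} :=
  if t is t'.+1 then (xfil t.+1 :&: \bigcap_(k < n) y k @^-1: rad t')%VS
  else 0%VS.

Lemma mem_radS t u :
  (u \in rad t.+1) = (u \in xfil t.+2) && [forall k, y k u \in rad t].
Proof.
rewrite memv_cap; congr (_ && _); apply/idP/forallP => [uc k|uc].
  rewrite memv_preim; apply: subvP uc.
  by apply: (bigcapv_inf k) => //; apply: subvv.
rewrite memvE; apply/subv_bigcapP => k _; rewrite -memvE -memv_preim; exact: uc.
Qed.

Lemma xfil_rad t : (xfil t <= rad t)%VS.
Proof.
elim: t => [|t IH]; first exact: sub0v.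
apply/subvP => u ut; rewrite mem_radS (subvP (xfilS _)) //=; apply/forallP => k.
by apply: (subvP IH); apply: (subvP (xfil_y t k)); apply: memv_img.
Qed.

Lemma rad_xfil t : (rad t <= xfil t.+1)%VS.
Proof. by case: t => [|t]; [apply: sub0v | apply: capvSl]. Qed.

Lemma rad_y t k : (y k @: rad t.+1 <= rad t)%VS.
Proof.
by apply/subvP => _ /memv_imgP[u + ->]; rewrite mem_radS => /andP[_ /forallP].
Qed.

Lemma rad_stable t : sym_stable (rad t).
Proof.
elim: t => [|t /sym_stableP IH]; first by move=> g; rewrite limg0.
apply/sym_stableP => g u; rewrite !mem_radS => /andP[ut /forallP yu].
have /sym_stableP -> // := @xfil_stable t.+2.
apply/forallP => k; rewrite -(permKV g k) -Ly; exact: IH.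
Qed.

(** Up to group elements, y_i x_k u is x_k y_i u, and y_i u lies one step lower, so induction
    applies. Together with [rad_y] and [rad_stable] this gives the second chain to which
    [trace_chain] applies. *)
Lemma rad_x t k : (x k @: rad t <= rad t.+1)%VS.
Proof.
elim: t k => [|t IH] k; first by rewrite limg0 sub0v.
apply/subvP => _ /memv_imgP[u ut ->]; rewrite mem_radS.
rewrite (subvP (xfil_x _ k)) ?memv_img ?(subvP (rad_xfil _)) //=.
apply/forallP => i; rewrite -[y i _](subrK (x k (y i u))) rpredD //.
  exact: (commutator_mem _ _ (@rad_stable t.+1)).
by apply: (subvP (IH k)); apply/memv_img/(subvP (rad_y t i)); apply: memv_img.
Qed.

Lemma sum_trace_chain (C : nat -> {vspace E}) :
    (forall t, sym_stable (C t)) ->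
  (D * \sum_(t < D) \dim (sym_proj @: C t))%:R = (\sum_(t < D) \dim (C t))%:R +
    \sum_(w | w != 1%g) \sum_(t < D) trace_on (C t) (L w).
Proof.
move=> sC; rewrite big_distrr /= !natr_sum exchange_big -big_split /=.
by apply: eq_bigr => t _; rewrite -trace_sym_sumE trace_sym_sum.
Qed.

(* As the sums of the traces of w <> 1 agree on both chains, the dimensions of
   [rad t] modulo [xfil t] add up to a multiple of n!; since [rad 0] is 0 and
   [xfil 1] is not, this multiple is less than n!. *)
Lemma rad_eq t : (t < D)%N -> rad t = xfil t.
Proof.
have xr w : w != 1%g -> \sum_(t < D) trace_on (xfil t) (L w) =
                        \sum_(t < D) trace_on (rad t) (L w).
  move=> /nontrivial_permE[i [j [w' w'i Lw]]].
  rewrite !(trace_chain _ w'i Lw) //;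
    [|exact: rad_stable|exact: rad_x|exact: rad_y
     |exact: xfil_stable|exact: xfil_x|exact: xfil_y].
  (* By [trace_chain] both sums reduce to a trace on the last term, and the two last terms are the
     whole space. *)
  suff -> : rad D = xfil D by [].
  by apply/eqP; rewrite eqEsubv xfil_rad xfil_full subvf.
have := sum_trace_chain rad_stable; have := sum_trace_chain xfil_stable.
rewrite (eq_bigr _ xr).
set a := (\sum_(t < D) \dim (sym_proj @: xfil t))%N.
set b := (\sum_(t < D) \dim (sym_proj @: rad t))%N.
set R := \sum_(w | _) _ => ha hb.
have {ha hb} e : (D * b + \sum_(t < D) \dim (xfil t) =
            D * a + \sum_(t < D) \dim (rad t))%N.
  apply/eqP; rewrite -(eqr_nat K) !natrD ha hb.
  by rewrite addrAC [X in X + R]addrC addrAC.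
have lt : (\sum_(t < D) \dim (rad t) < \sum_(t < D) \dim (xfil t) + D)%N.
  have -> : (\sum_(t < D) \dim (xfil t) + D = \sum_(t < D) \dim (xfil t.+1))%N.
    have <- : (\sum_(t < D.+1) \dim (xfil t) = \sum_(t < D) \dim (xfil t) + D)%N.
      by rewrite big_ord_recr /= xfil_full dimE.
    by rewrite big_ord_recl /= dimv0 add0n.
  rewrite -(prednK (fact_gt0 n : 0 < D)%N) !big_ord_recl /= dimv0 add0n.
  rewrite -add1n leq_add //.
    by rewrite lt0n dimv_eq0 -subv0; apply: contraNN U0 => H; rewrite -subv0;
       apply: subv_trans H; exact: (xfil_U 0).
  by apply: leq_sum => i _; exact: (dimvS (rad_xfil i.+1)).
have le s : (\dim (xfil s) <= \dim (rad s))%N by apply/dimvS/xfil_rad.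
have les : (\sum_(t < D) \dim (xfil t) <= \sum_(t < D) \dim (rad t))%N.
  by apply: leq_sum.
have eqs : (\sum_(t < D) \dim (xfil t) = \sum_(t < D) \dim (rad t))%N.
  have D0 : (0 < D)%N := fact_gt0 n.
  have ab : (a <= b)%N.
    by apply: leq_sum => i _; apply/dimvS/limgS/xfil_rad.
  have ba : (b <= a)%N.
    rewrite -ltnS -(ltn_pmul2l D0) mulnS addnC -(ltn_add2r (\sum_(t < D) \dim (xfil t))).
    by rewrite e -addnA ltn_add2l addnC.
  have ea : a = b by apply/eqP; rewrite eqn_leq ab ba.
  by move: e; rewrite ea => /addnI.
move=> tD; apply/eqP; rewrite eq_sym eqEdim xfil_rad /=.
have := leqif_sum (fun (s : 'I_D) (_ : xpredT s) => leqif_geq (le s)).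
by case=> _; rewrite eqs eqxx => /esym/forallP/(_ (Ordinal tD)).
Qed.

(** If u lies in [xfil t.+2], then it lies in [rad t.+1] since all y_k u vanish, hence in
    [xfil t.+1] by [rad_eq]. Descending from [xfil D], which is everything, one ends in [xfil 1],
    which is U. *)
Theorem killed_mem u : (forall k, y k u = 0) -> u \in U.
Proof.
move=> yu.
have H t : (t < D)%N -> u \in xfil t.+1 -> u \in U.
  elim: t => [|t IH] tD ut.
    move: ut; rewrite /= addv0 big1 ?addv0 // => k _; exact: limg0.
  apply: IH; first exact: ltnW.
  rewrite -rad_eq // mem_radS ut; apply/forallP => k.
  by rewrite yu mem0v.
by apply: (H D.-1); rewrite prednK ?fact_gt0 // xfil_full memvf.
Qed.

End Killed.
End Cherednik.

(** * The signed permutation action on the tensor power *)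

Section Signs.
Variable l : nat.
Implicit Types (s t : 'S_l) (o : 'I_l -> bool) (g : 'I_l -> 'I_l -> bool).

(** Signs are tracked by their exponents modulo 2, as booleans under exclusive or. *)
Definition xor_lt g : bool :=
  \big[addb/false]_(u : 'I_l * 'I_l | (u.1 < u.2)%N) g u.1 u.2.

Definition xor_before o (i : 'I_l) : bool :=
  \big[addb/false]_(k < l | (k < i)%N) o k.

(** For symmetric g this is a sum over unordered pairs, which t permutes. *)
Lemma xor_lt_perm g t : (forall p q, g p q = g q p) ->
  xor_lt (fun p q => g (t p) (t q)) = xor_lt g.
Proof.
move=> gC; have tt_inj : injective (fun u : 'I_l * 'I_l => (t u.1, t u.2)).
  by move=> [a b] [c d] [/perm_inj-> /perm_inj->].
rewrite [RHS](reindex_inj tt_inj) /= /xor_lt.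
rewrite (bigID (fun u : 'I_l * 'I_l => (t u.1 < t u.2)%N)) /=.
rewrite [RHS](bigID (fun u : 'I_l * 'I_l => (u.1 < u.2)%N)) /=; congr (_ (+) _).
  by apply: eq_bigl => u; rewrite andbC.
have sw_inj : injective (fun u : 'I_l * 'I_l => (u.2, u.1)).
  by move=> [a b] [c d] [-> ->].
rewrite [RHS](reindex_inj sw_inj) /=; apply: eq_big => [[p q]|u _]; last exact: gC.
rewrite /=; case: (ltngtP p q) => [||/val_inj->]; last by rewrite !ltnn.
  by case: (ltngtP (t p) (t q)) => // /val_inj/perm_inj->; rewrite ltnn.
by case: (ltngtP (t p) (t q)) => // /val_inj/perm_inj->; rewrite ltnn.
Qed.

Lemma eq_xor_lt g g' : (forall p q : 'I_l, (p < q)%N -> g p q = g' p q) ->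
  xor_lt g = xor_lt g'.
Proof. by move=> gg'; apply: eq_bigr => u; apply: gg'. Qed.

Lemma xor_ltD g g' : xor_lt (fun p q => g p q (+) g' p q) = xor_lt g (+) xor_lt g'.
Proof. exact: big_split. Qed.

(** Comparing both orders by exclusive or makes the condition symmetric in p and q, as [xor_lt_perm]
    requires. *)
Definition inverted s o (p q : 'I_l) : bool :=
  ((q < p)%N (+) (s q < s p)%N) && (o (s p) && o (s q)).

(* The exponent of the sign produced by rearranging the letters, of parities o,
   so that the letter in position s k moves to position k. *)
Definition perm_parity s o : bool := xor_lt (inverted s o).

Lemma invertedC s o p q : inverted s o p q = inverted s o q p.
Proof.
rewrite /inverted [o (s q) && _]andbC; congr (_ && _).
case: (ltngtP p q) => [pq|pq|/val_inj->]; rewrite ?ltnn // ;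
case: (ltngtP (s p) (s q)) => // /val_inj/perm_inj e; by rewrite e ltnn in pq.
Qed.

(** The cocycle identity behind [perm_actM]: a pair of odd letters is inverted by the composite when
    exactly one of the two steps inverts it. *)
Lemma perm_parityM t s o :
  perm_parity (t * s)%g o = perm_parity s o (+) perm_parity t (fun k => o (s k)).
Proof.
rewrite /perm_parity -(xor_lt_perm t (invertedC s o)) -xor_ltD.
apply: eq_xor_lt => p q pq; rewrite /inverted !permM.
by case: (q < p)%N (t q < t p)%N (s (t q) < _)%N (o _ && o _) => [] [] [] [].
Qed.

Lemma perm_parity1 o : perm_parity 1%g o = false.
Proof.
rewrite /perm_parity /xor_lt big1 // => -[p q] _.
by rewrite /inverted !perm1 addbb.
Qed.

Lemma xor_lt_row g i : (forall p q, g p q = g q p) -> g i i = false ->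
    (forall p q, p != i -> q != i -> g p q = false) ->
  xor_lt g = \big[addb/false]_k g i k.
Proof.
move=> gC gii g0.
have -> : xor_lt g = \big[addb/false]_(p < l) \big[addb/false]_(q < l | (p < q)%N) g p q.
  by rewrite pair_big_dep.
rewrite (bigD1 i) //= [RHS](bigID (fun k : 'I_l => (i < k)%N)) /=; congr (_ (+) _).
rewrite [LHS]big_mkcond [RHS]big_mkcond; apply: eq_bigr => p _ /=.
rewrite -leqNgt; have [->|pi] := eqVneq p i; first by rewrite leqnn gii.
rewrite leq_eqVlt (inj_eq val_inj) (negPf pi) /=; case: ifP => pli.
  rewrite (bigD1 i) //= gC big1 ?addbF // => q /andP[_ qi]; exact: g0.
by rewrite big1 // => q pq; apply: g0 => //; apply: contraTneq pq => ->; rewrite pli.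
Qed.

Lemma xor_beforeD o o' i :
  xor_before (fun k => o k (+) o' k) i = xor_before o i (+) xor_before o' i.
Proof. exact: big_split. Qed.

Lemma xor_before_delta (i j : 'I_l) b :
  xor_before (fun k => (k == i) && b) j = (i < j)%N && b.
Proof.
rewrite /xor_before; have [ij|ij] := boolP (i < j)%N.
  by rewrite (bigD1 i) //= eqxx big1 ?addbF // => k /andP[_ /negPf->].
rewrite big1 // => k kj; case: eqP kj => // ->; by rewrite (negPf ij).
Qed.

Lemma eq_xor_before o o' (i : 'I_l) : (forall k : 'I_l, (k < i)%N -> o k = o' k) ->
  xor_before o i = xor_before o' i.
Proof. by move=> oo'; apply: eq_bigr => k; apply: oo'. Qed.

(** Only pairs containing i change, and each contributes the parity of a letter lying before the
    changed one in exactly one of the two arrangements. This compares the signs of a matrix unit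
    before and after a permutation. *)
Lemma perm_parity_update s o o' i b : o' (s i) = b (+) o (s i) ->
    (forall k, k != s i -> o' k = o k) ->
  perm_parity s o' =
  perm_parity s o (+) (b && (xor_before (o \o s) i (+) xor_before o (s i))).
Proof.
move=> oi ok; pose d p q := inverted s o' p q (+) inverted s o p q.
suff -> : b && (xor_before (o \o s) i (+) xor_before o (s i)) = xor_lt d.
  by rewrite -xor_ltD; apply: eq_xor_lt => p q _; rewrite /d addbC addbK.
have oks k : k != i -> o' (s k) = o (s k) by move=> ki; rewrite ok // (inj_eq perm_inj).
rewrite (@xor_lt_row _ i); first last.
- by move=> p q pi qi; rewrite /d /inverted !oks // addbb.
- by rewrite /d /inverted !ltnn.
- by move=> p q; rewrite /d ![inverted _ _ p q]invertedC.
rewrite /xor_before [X in _ (+) X](reindex_inj (@perm_inj _ s)) /=.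
rewrite [X in X (+) _]big_mkcond [X in _ (+) X]big_mkcond -big_split /=.
rewrite (big_morph (andb b) (andb_addr b) (andbF b)).
apply: eq_bigr => k _; rewrite /d /inverted oi.
have [->|ki] := eqVneq k i; first by rewrite !ltnn andbF.
rewrite oks //.
by case: (k < i)%N (s k < s i)%N (o (s i)) (o (s k)) (b) => [] [] [] [] [].
Qed.

(** The right-hand side is the sign produced by the two matrix units in a Hamiltonian. With even
    letters at i and j no two odd letters are inverted; the true letters are restored one at a time
    by [perm_parity_update]. *)
Lemma perm_parity_tperm o (i j : 'I_l) : i != j ->
  perm_parity (tperm i j) o = o i (+) ((o i (+) o j) &&
   (xor_before o j (+) xor_before (fun k => if k == j then o i else o k) i)).
Proof.
move=> ij; set s := tperm i j.
pose o1 k := if k == j then false else o k.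
pose o0 k := if k == i then false else o1 k.
have ji : (j == i) = false by rewrite eq_sym (negPf ij).
have P0 : perm_parity s o0 = false.
  rewrite /perm_parity /xor_lt big1 // => -[p q] _ /=.
  rewrite /inverted /o0 /o1 /s.
  case: tpermP => [->|->|pi pj]; rewrite ?eqxx ?ji ?andbF //.
  case: tpermP => [->|->|qi qj]; rewrite ?eqxx ?ji ?andbF //.
  by rewrite addbb.
have si : s i = j by rewrite /s tpermL.
have sj : s j = i by rewrite /s tpermR.
have e1 : o1 (s i) = o j (+) o (s i) by rewrite si /o1 eqxx addbb.
have e0 : o0 (s j) = o i (+) o1 (s j).
  by rewrite sj /o0 eqxx /o1 (negPf ij) addbb.
move: P0; rewrite (perm_parity_update e0) => [|k]; last by rewrite sj /o0 => /negPf->.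
rewrite (perm_parity_update e1) => [|k]; last by rewrite si /o1 => /negPf->.
rewrite si sj.
set A := xor_before o j; set A' := xor_before (fun k => if k == j then o i else o k) i.
have tk k : (k == i) = false -> (k == j) = false -> s k = k.
  by move=> /negbT ki /negbT kj; rewrite /s tpermD // eq_sym.
have -> : xor_before (o \o s) i = A'.
  apply: eq_xor_before => k ki /=; have {}ki : (k == i) = false.
    by apply: contraTF ki => /eqP->; rewrite ltnn.
  by have [->|/negPf kj] := eqVneq k j; rewrite ?sj ?tk.
have -> : xor_before (o1 \o s) j = A (+) ((i < j)%N && o i).
  rewrite -xor_before_delta -xor_beforeD; apply: eq_xor_before => k kj /=.
  have {}kj : (k == j) = false by apply: contraTF kj => /eqP->; rewrite ltnn.
  have [->|/negPf ki] := eqVneq k i; first by rewrite si /o1 eqxx addbb.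
  by rewrite tk // /o1 kj addbF.
have -> : xor_before o1 i = A' (+) ((j < i)%N && o i).
  rewrite -xor_before_delta -xor_beforeD; apply: eq_xor_before => k ki /=.
  by rewrite /o1; case: (k == j); rewrite ?addbb ?addbF.
have : (i < j)%N (+) (j < i)%N by case: ltngtP ij => // /val_inj->; rewrite eqxx.
by case: (i < j)%N (j < i)%N (A) (A') (o i) (o j) (perm_parity s o)
  => [] [] // [] [] [] [] [].
Qed.

End Signs.

Section Words.
Variables (m n l : nat).
Implicit Types (a b : word m n l) (s t : 'S_l) (i j : 'I_l) (r q : 'I_(m + n)).

Definition word_par a (k : 'I_l) : bool := par (a k).

Definition word_perm s a : word m n l := [ffun k => a (s k)].

Lemma word_permM t s a : word_perm (t * s)%g a = word_perm t (word_perm s a).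
Proof. by apply/ffunP => k; rewrite !ffunE permM. Qed.

Lemma word_perm1 a : word_perm 1%g a = a.
Proof. by apply/ffunP => k; rewrite ffunE perm1. Qed.

Lemma word_par_perm s a k : word_par (word_perm s a) k = word_par a (s k).
Proof. by rewrite /word_par ffunE. Qed.

Lemma word_par_subst a i r k : word_par (subst_word a i r) k =
  word_par a k (+) ((k == i) && (par r (+) par (a i))).
Proof.
rewrite /word_par ffunE; case: eqP => [->|_] /=; last by rewrite addbF.
by rewrite [RHS]addbC addbK.
Qed.

Lemma xor_before_subst a i r j : xor_before (word_par (subst_word a i r)) j =
  xor_before (word_par a) j (+) ((i < j)%N && (par r (+) par (a i))).
Proof.
rewrite -xor_before_delta -xor_beforeD.
by apply: eq_xor_before => k _; rewrite word_par_subst.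
Qed.

Lemma subst_wordC a i j r q : i != j ->
  subst_word (subst_word a i r) j q = subst_word (subst_word a j q) i r.
Proof.
move=> ij; apply/ffunP => k; rewrite !ffunE.
by have [->|//] := eqVneq k i; rewrite (negPf ij).
Qed.

Lemma subst_word_same a i r q : subst_word (subst_word a i r) i q = subst_word a i q.
Proof. by apply/ffunP => k; rewrite !ffunE; case: eqP. Qed.

Lemma subst_word_perm s a i r :
  word_perm s (subst_word a (s i) r) = subst_word (word_perm s a) i r.
Proof. by apply/ffunP => k; rewrite !ffunE (inj_eq perm_inj). Qed.

Lemma eq_perm_parity s (o o' : 'I_l -> bool) : o =1 o' ->
  perm_parity s o = perm_parity s o'.
Proof.
by move=> oo'; rewrite /perm_parity; apply: eq_xor_lt => p q _; rewrite /inverted !oo'.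
Qed.

End Words.

(** * Signed permutations and matrix units on the tensor power *)

Section Operators.
Variables (K : fieldType) (m n l : nat).
Local Notation T := (tpow K m n l).
Local Notation tb := (tbasis K).
Implicit Types (u v : T) (a b : word m n l) (s t : 'S_l) (i j : 'I_l).
Implicit Types (r q : 'I_(m + n)).

Lemma tbasis_sum v : v = \sum_a (v a : K) *: tb a.
Proof.
apply/ffunP => b; rewrite sum_ffunE (bigD1 b) //= big1 => [|a ab].
  by rewrite !ffunE eqxx /GRing.scale /= mulr1 addr0.
by rewrite !ffunE eq_sym (negPf ab) scaler0.
Qed.

Lemma eq_lfun_tbasis (f g : 'End(T)) : (forall a, f (tb a) = g (tb a)) -> f = g.
Proof.
move=> fg; apply/lfunP => v; rewrite (tbasis_sum v) !linear_sum.
by apply: eq_bigr => a _; rewrite !linearZ /= fg.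
Qed.

(* MathComp composes permutations from left to right, so that s |-> [perm_act s]
   is a homomorphism although [word_perm] precomposes words with s. *)
Definition perm_act s : 'End(T) := linfun (lin_ext (fun a =>
  (-1) ^+ perm_parity s (word_par a) *: tb (word_perm s a))).

Lemma perm_act_basis s a : perm_act s (tb a) =
  (-1) ^+ perm_parity s (word_par a) *: tb (word_perm s a).
Proof. by rewrite lfunE /= lin_ext_basis. Qed.

Lemma perm_actM t s u : perm_act (t * s)%g u = perm_act t (perm_act s u).
Proof.
rewrite -comp_lfunE; congr (fun_of_lfun _ u); apply: eq_lfun_tbasis => a.
rewrite comp_lfunE !perm_act_basis linearZ /= perm_act_basis scalerA.
rewrite perm_parityM signr_addb word_permM.
by rewrite (@eq_perm_parity _ t (word_par (word_perm s a)) _ (@word_par_perm _ _ _ s a)).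
Qed.

Lemma perm_act1 : perm_act 1%g = \1%VF.
Proof.
apply: eq_lfun_tbasis => a.
by rewrite perm_act_basis perm_parity1 scale1r word_perm1 id_lfunE.
Qed.

Lemma perm_actVK s u : perm_act s^-1%g (perm_act s u) = u.
Proof. by rewrite -perm_actM mulVg perm_act1 id_lfunE. Qed.

(** [perm_act s] is a signed permutation matrix; hence shifts will preserve the span of the matrix
    coefficients of a vector. *)
Lemma perm_act_coord s b : exists (c : K) b',
  forall v, (perm_act s v) b = c * v b'.
Proof.
exists ((-1) ^+ perm_parity s (word_par (word_perm s^-1%g b))), (word_perm s^-1%g b).
move=> v; rewrite {1}(tbasis_sum v) linear_sum sum_ffunE.
rewrite (bigD1 (word_perm s^-1%g b)) //= big1 => [|a ab]; last first.
  rewrite linearZ /= perm_act_basis !ffunE; case: eqP => [e|]; last by rewrite !scaler0.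
  by case/eqP: ab; rewrite e -word_permM mulVg word_perm1.
rewrite linearZ /= perm_act_basis !ffunE -word_permM mulgV word_perm1 eqxx addr0.
by rewrite /GRing.scale /= mulr1 mulrC.
Qed.

Lemma sign_xor_before (b : bool) a i :
  (-1) ^+ (b * \sum_(k < l | (k < i)%N) par (a k))%N =
  (-1) ^+ (b && xor_before (word_par a) i) :> K.
Proof.
rewrite -signr_odd oddM oddb (big_morph odd oddD (erefl : odd 0 = false)).
by congr (_ ^+ (_ && _)); apply: eq_bigr => k _; rewrite oddb.
Qed.

Lemma Efac_tbasis i r q a : Efac K i r q (tb a) =
  if a i == q then (-1) ^+ ((par r (+) par q) && xor_before (word_par a) i) *:
    tb (subst_word a i r) else 0.
Proof. by rewrite Efac_basis sign_xor_before. Qed.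

Lemma perm_act_Efac s i r q u :
  perm_act s (Efac K (s i) r q u) = Efac K i r q (perm_act s u).
Proof.
rewrite -!comp_lfunE; congr (fun_of_lfun _ u); apply: eq_lfun_tbasis => a.
rewrite !comp_lfunE perm_act_basis linearZ /= !Efac_tbasis ffunE.
case: eqP => [aq|_]; last by rewrite linear0 scaler0.
rewrite linearZ /= perm_act_basis !scalerA -!signr_addb subst_word_perm.
congr ((-1) ^+ (nat_of_bool _) *: _).
rewrite (@perm_parity_update _ s (word_par a) _ i (par r (+) par q)); first last.
- by move=> k ki; rewrite word_par_subst (negPf ki) addbF.
- by rewrite word_par_subst eqxx aq addbC.
rewrite (@eq_xor_before _ (word_par (word_perm s a)) (word_par a \o s)); last first.
  by move=> k _; rewrite word_par_perm.
by rewrite andb_addr addbC -!addbA addbb addbF.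
Qed.

Lemma Efac_comm i j r q r' q' u : i != j ->
  Efac K i r q (Efac K j r' q' u) =
  (-1) ^+ ((par r (+) par q) && (par r' (+) par q')) *:
    Efac K j r' q' (Efac K i r q u).
Proof.
move=> ij; rewrite -!comp_lfunE -scale_lfunE; congr (fun_of_lfun _ u).
apply: eq_lfun_tbasis => a; rewrite scale_lfunE !comp_lfunE !Efac_tbasis.
case: eqP => [aj|aj]; case: eqP => [ai|ai]; rewrite ?linear0 ?scaler0 //; last first.
- rewrite linearZ /= Efac_tbasis ffunE [j == i]eq_sym (negPf ij).
  by rewrite (introF eqP aj) !scaler0.
- by rewrite linearZ /= Efac_tbasis ffunE (negPf ij) (introF eqP ai) !scaler0.
rewrite !linearZ /= !Efac_tbasis !ffunE (negPf ij) [j == i]eq_sym (negPf ij) ai aj !eqxx.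
rewrite [subst_word (subst_word a j r') i r]subst_wordC 1?eq_sym //.
rewrite !scalerA -!signr_addb !xor_before_subst ai aj.
congr ((-1) ^+ (nat_of_bool _) *: _).
have : (i < j)%N (+) (j < i)%N by case: ltngtP ij => // /val_inj->; rewrite eqxx.
by case: (i < j)%N (j < i)%N (par r (+) _) (par r' (+) _) (xor_before _ _)
  (xor_before _ _) => [] [] [] [] [] [].
Qed.

Lemma Efac_same i r q r' q' u : Efac K i r q (Efac K i r' q' u) =
  if q == r' then Efac K i r q' u else 0.
Proof.
suff -> : Efac K i r q (Efac K i r' q' u) = (q == r')%:R *: Efac K i r q' u.
  by case: eqP => _; rewrite ?scale1r ?scale0r.
rewrite -!comp_lfunE -scale_lfunE; congr (fun_of_lfun _ u).
apply: eq_lfun_tbasis => a; rewrite scale_lfunE !comp_lfunE !Efac_tbasis.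
case: eqP => [aq|_]; last by rewrite linear0 scaler0.
rewrite linearZ /= Efac_tbasis ffunE eqxx [r' == q]eq_sym.
case: eqP => [e|_]; last by rewrite scaler0 scale0r.
rewrite scale1r scalerA -signr_addb subst_word_same xor_before_subst ltnn addbF e.
by rewrite -andb_addl addbC addbA addbK.
Qed.

(** On a word a only the term with r = a j and s = a i survives, and it swaps these two letters up
    to the sign of the super flip. *)
Lemma gaudin_perm_act (z : 'I_l -> K) i :
  gaudin m n z i = \sum_(j < l | j != i) (z i - z j)^-1 *: perm_act (tperm i j).
Proof.
rewrite /gaudin; apply: eq_bigr => j ji; congr (_ *: _).
have ij : (i == j) = false by rewrite eq_sym (negPf ji).
apply: eq_lfun_tbasis => a; rewrite perm_act_basis sum_lfunE.
rewrite (bigD1 (a j)) //= [X in _ + X]big1 ?addr0 => [|r rj]; last first.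
  rewrite sum_lfunE big1 // => q _; rewrite scale_lfunE comp_lfunE Efac_tbasis.
  by rewrite [a j == r]eq_sym (negPf rj) linear0 scaler0.
rewrite sum_lfunE (bigD1 (a i)) //= big1 ?addr0 => [|q qi]; last first.
  rewrite scale_lfunE comp_lfunE Efac_tbasis eqxx linearZ /= Efac_tbasis ffunE.
  by rewrite ij [a i == q]eq_sym (negPf qi) !scaler0.
rewrite scale_lfunE comp_lfunE !Efac_tbasis eqxx linearZ /= Efac_tbasis ffunE.
rewrite ij eqxx !scalerA -!signr_addb.
have -> : subst_word (subst_word a j (a i)) i (a j) = word_perm (tperm i j) a.
  apply/ffunP => k; rewrite !ffunE; case: tpermP => [->|->|/eqP/negPf-> /eqP/negPf->//].
    by rewrite eqxx.
  by rewrite (negPf ji) eqxx.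
congr ((-1) ^+ (nat_of_bool _) *: _).
rewrite perm_parity_tperm 1?eq_sym //.
rewrite (@eq_xor_before _ (fun k => if k == j then _ else _)
          (word_par (subst_word a j (a i)))); last first.
  by move=> k _; rewrite /word_par ffunE; case: ifP.
rewrite /word_par [par (a j) (+) _]addbC.
by case: (par (a i)) (par (a j)) (xor_before _ _) (xor_before _ _) => [] [] [] [].
Qed.

Lemma perm_act_Etens s r q u :
  perm_act s (Etens K l r q u) = Etens K l r q (perm_act s u).
Proof.
rewrite /Etens !sum_lfunE linear_sum (reindex_inj (@perm_inj _ s)) /=.
by apply: eq_bigr => i _; rewrite perm_act_Efac.
Qed.

End Operators.

(** * The Cherednik representation attached to joint eigenvalues *)

Lemma mulVBl (K : fieldType) (a b x : K) : a - b != 0 ->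
  (a - b)^-1 * (a * x) = b * ((a - b)^-1 * x) + x.
Proof.
move=> ab; rewrite -[X in _ = _ + X](mulKf ab) [b * _]mulrCA -mulrDr -mulrDl.
by rewrite [b + _]addrC subrK.
Qed.

Section PermFunctions.
Variables (K : numFieldType) (l : nat) (z c : 'I_l -> K).
Hypothesis z_inj : injective z.
Local Notation E := {ffun 'S_l -> K^o}.

Lemma dim_perm_fun : \dim {: E} = l`!.
Proof. by rewrite dimvf /dim /= muln1 card_Sn. Qed.

Definition shift_fun (g : 'S_l) (f : E) : E := [ffun w => f (g * w)%g].
Definition pos_fun (k : 'I_l) (f : E) : E := [ffun w : 'S_l => z (w k) * f w].
(** A Dunkl operator at t = 0, with multiplication by c_(w k) in place of the derivative. The
    eigenvalue equations of v say that it kills the functions sending w to a coordinate of w v. *)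
Definition dunkl_fun (k : 'I_l) (f : E) : E := [ffun w : 'S_l =>
  c (w k) * f w - \sum_(j | j != k) (z (w k) - z (w j))^-1 * f (tperm k j * w)%g].

Lemma shift_fun_linear g : linear (shift_fun g).
Proof. by move=> a f h; apply/ffunP => w; rewrite !ffunE. Qed.
HB.instance Definition _ g :=
  GRing.isLinear.Build K E E _ (shift_fun g) (shift_fun_linear g).

Lemma pos_fun_linear k : linear (pos_fun k).
Proof.
by move=> a f h; apply/ffunP => w; rewrite !ffunE /GRing.scale /= mulrDr mulrCA.
Qed.
HB.instance Definition _ k :=
  GRing.isLinear.Build K E E _ (pos_fun k) (pos_fun_linear k).

Lemma dunkl_fun_linear k : linear (dunkl_fun k).
Proof.
move=> a f h; apply/ffunP => w; rewrite !ffunE /GRing.scale /= mulrDr mulrCA.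
rewrite mulrBr mulr_sumr [_ - _ + _]addrACA -opprD -big_split /=; congr (_ - _).
by apply: eq_bigr => j _; rewrite !ffunE mulrDr mulrCA.
Qed.
HB.instance Definition _ k :=
  GRing.isLinear.Build K E E _ (dunkl_fun k) (dunkl_fun_linear k).

Definition shift g : 'End(E) := linfun (shift_fun g).
Definition pos k : 'End(E) := linfun (pos_fun k).
Definition dunkl k : 'End(E) := linfun (dunkl_fun k).

Lemma shiftE g f w : shift g f w = f (g * w)%g.
Proof. by rewrite lfunE /= ffunE. Qed.
Lemma posE k f w : pos k f w = z (w k) * f w.
Proof. by rewrite lfunE /= ffunE. Qed.
Lemma dunklE k f w : dunkl k f w = c (w k) * f w -
  \sum_(j | j != k) (z (w k) - z (w j))^-1 * f (tperm k j * w)%g.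
Proof. by rewrite lfunE /= ffunE. Qed.

Lemma shift1 : shift 1%g = \1%VF.
Proof. by apply/lfunP => f; apply/ffunP => w; rewrite shiftE mul1g id_lfunE. Qed.

Lemma shiftM g h f : shift (g * h)%g f = shift h (shift g f).
Proof. by apply/ffunP => w; rewrite !shiftE mulgA. Qed.

Lemma shift_pos g k f : shift g (pos k f) = pos (g k) (shift g f).
Proof. by apply/ffunP => w; rewrite shiftE !posE shiftE permM. Qed.

Lemma shift_dunkl g k f : shift g (dunkl k f) = dunkl (g k) (shift g f).
Proof.
apply/ffunP => w; rewrite shiftE !dunklE shiftE permM; congr (_ - _).
rewrite [RHS](reindex_inj (@perm_inj _ g)) /=; apply: eq_big => j.
  by rewrite (inj_eq perm_inj).
move=> _; rewrite permM shiftE !mulgA; congr (_ * f (_ * _)%g).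
by rewrite -tpermJ conjgE !mulgA mulgV mul1g.
Qed.

(** Only the transposition of i and j changes the j-th coordinate function, by a difference that
    cancels the denominator ([mulVBl]). *)
Lemma dunkl_pos_comm i j f : i != j ->
  dunkl i (pos j f) = pos j (dunkl i f) - shift (tperm i j) f.
Proof.
move=> ij; apply/ffunP => w; rewrite !ffunE posE !dunklE posE shiftE.
rewrite mulrBr mulrCA -addrA -opprD; congr (_ - _).
rewrite (bigD1 j) 1?eq_sym //= [in RHS](bigD1 j) 1?eq_sym //= posE permM tpermR.
rewrite mulrDr -addrA [X in _ = _ + X]addrC addrA; congr (_ + _).
  by apply: mulVBl; rewrite subr_eq0 (inj_eq z_inj) (inj_eq perm_inj).
rewrite mulr_sumr; apply: eq_bigr => k /andP[ki kj].
by rewrite posE permM tpermD // 1?eq_sym // mulrCA.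
Qed.

Lemma dunkl_pos_same i f :
  dunkl i (pos i f) = pos i (dunkl i f) + \sum_(k | k != i) shift (tperm i k) f.
Proof.
apply/ffunP => w; rewrite !ffunE sum_ffunE posE !dunklE posE.
rewrite mulrBr mulrCA -addrA; congr (_ + _).
rewrite mulr_sumr -!sumrN -big_split /=; apply: eq_bigr => k ki.
rewrite posE permM tpermL shiftE. rewrite [z (w i) * _]mulrCA mulVBl; last first.
  by rewrite subr_eq0 (inj_eq z_inj) (inj_eq perm_inj) eq_sym.
by rewrite opprD subrK mulrCA.
Qed.

End PermFunctions.

(** * Matrix coefficients of joint eigenvectors *)

Section MatrixCoefficients.
Variables (K : numFieldType) (m n l : nat) (z c : 'I_l -> K).
Hypothesis z_inj : injective z.
Local Notation T := (tpow K m n l).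
Local Notation E := {ffun 'S_l -> K^o}.

Definition matcoef (v : T) (b : word m n l) : E := [ffun w => perm_act K m n w v b].

Lemma matcoef_shift g b : exists (d : K) b', forall v,
  shift K g (matcoef v b) = d *: matcoef v b'.
Proof.
have [d [b' H]] := perm_act_coord K g b; exists d, b' => v.
by apply/ffunP => w; rewrite shiftE !ffunE perm_actM H.
Qed.

Lemma matcoef_dunkl v b k : (forall i, gaudin m n z i v = c i *: v) ->
  dunkl z c k (matcoef v b) = 0.
Proof.
move=> Hv; apply/ffunP => w; rewrite dunklE !ffunE.
have -> : c (w k) * perm_act K m n w v b = perm_act K m n w (c (w k) *: v) b.
  by rewrite linearZ ffunE.
rewrite -Hv gaudin_perm_act sum_lfunE linear_sum sum_ffunE.
rewrite (reindex_inj (@perm_inj _ w)) /=.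
rewrite (eq_bigl (fun j => j != k)) => [|j]; last by rewrite (inj_eq perm_inj).
apply/eqP; rewrite subr_eq0; apply/eqP; apply: eq_bigr => j _.
rewrite scale_lfunE linearZ /= ffunE -perm_actM ffunE; congr (_ * perm_act K m n _ v b).
by rewrite -tpermJ conjgE !mulgA mulgV mul1g.
Qed.

(** The coefficients of v1 span a nonzero S_l-stable space killed by the y_k, so [killed_mem] puts
    the coefficients of v2 in it; h records the expansions. *)
Lemma matcoef_intertwine v1 v2 : v1 != 0 ->
    (forall i, gaudin m n z i v1 = c i *: v1) ->
    (forall i, gaudin m n z i v2 = c i *: v2) ->
  exists h : word m n l -> word m n l -> K, forall w b,
    perm_act K m n w v2 b = \sum_b' h b b' * perm_act K m n w v1 b'.
Proof.
move=> v10 Hv1 Hv2.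
pose U := (\sum_b <[matcoef v1 b]>)%VS.
have memU b : matcoef v1 b \in U.
  by rewrite memvE; apply: (sumv_sup b).
have sU : sym_stable (@shift K l) U.
  move=> g; rewrite limg_sum; apply/subv_sumP => b _; rewrite limg_line -memvE.
  have [d [b' e]] := matcoef_shift g b; rewrite e; apply: memvZ; exact: memU.
(* At the identity permutation the coefficients are the coordinates of v1. *)
have U0 : U != 0%VS.
  apply: contraNneq v10 => U0; apply/eqP/ffunP => b.
  have := memU b; rewrite U0 memv0 => /eqP/ffunP/(_ 1%g).
  by rewrite !ffunE perm_act1 id_lfunE.
have yU k u : u \in U -> dunkl z c k u = 0.
  suff /subvP H : (U <= lker (dunkl z c k))%VS by move/H; rewrite memv_ker => /eqP.
  by apply/subv_sumP => b _; rewrite -memvE memv_ker matcoef_dunkl.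
have inU b : matcoef v2 b \in U.
  apply: (killed_mem (dim_perm_fun K l) (@shift1 K l) (@shiftM K l)
    (shift_pos z) (shift_dunkl z c) (dunkl_pos_comm c z_inj)
    (dunkl_pos_same c z_inj) sU U0 yU) => k.
  exact: matcoef_dunkl.
have /fin_all_exists[h Hh] b : exists hb : word m n l -> K,
    matcoef v2 b = \sum_b' hb b' *: matcoef v1 b'.
  have /memv_sumP[us us_in ->] := inU b.
  have /fin_all_exists[hb Hhb] b' : exists k, us b' = k *: matcoef v1 b'.
    by apply/vlineP/us_in.
  by exists hb; apply: eq_bigr => b' _.
exists h => w b; have /ffunP/(_ w) := Hh b.
rewrite ffunE => ->; rewrite sum_ffunE.
by apply: eq_bigr => b' _; rewrite !ffunE.
Qed.

End MatrixCoefficients.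

(** * The Hermitian form *)

Section HermitianForm.
Variables (K : numClosedFieldType) (m n l : nat).
Local Notation T := (tpow K m n l).
Local Notation tb := (tbasis K).
Implicit Types (u v : T) (f g : 'End(T)).

Definition dot u v : K := \sum_a (u a)^* * v a.

Lemma dot_is_linear u : linear (dot u : T -> K^o).
Proof.
move=> c v w; rewrite /dot /GRing.scale /= mulr_sumr -big_split /=.
by apply: eq_bigr => a _; rewrite !ffunE mulrDr mulrCA.
Qed.
HB.instance Definition _ u := GRing.isLinear.Build K T K^o _ (dot u) (dot_is_linear u).

Lemma dotZr u (c : K) v : dot u (c *: v) = c * dot u v.
Proof. exact: linearZ. Qed.

Lemma dotC u v : dot u v = (dot v u)^*.
Proof.
rewrite /dot rmorph_sum; apply: eq_bigr => a _.
by rewrite rmorphM /= conjCK mulrC.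
Qed.

Lemma dot_eq0 u : dot u u = 0 -> u = 0.
Proof.
have pos a : true -> 0 <= (u a)^* * u a by rewrite mulrC mul_conjC_ge0.
move/eqP; rewrite /dot psumr_eq0 // => /allP H; apply/ffunP => a.
have := H a (mem_index_enum a); rewrite mulrC mul_conjC_eq0 ffunE => /eqP ->.
by [].
Qed.

Lemma dot0l v : dot 0 v = 0.
Proof. by rewrite dotC linear0 rmorph0. Qed.

Definition adjoint f g := forall u v, dot (f u) v = dot u (g v).

Lemma adjoint_basis f g :
  (forall a b, (f (tb a) b)^* = g (tb b) a) -> adjoint f g.
Proof.
move=> fg u v; rewrite /dot.
under eq_bigr => b _ do
  rewrite {1}(tbasis_sum u) linear_sum sum_ffunE rmorph_sum mulr_suml.
rewrite exchange_big; apply: eq_bigr => a _ /=.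
rewrite {2}(tbasis_sum v) linear_sum sum_ffunE mulr_sumr; apply: eq_bigr => b _.
by rewrite !linearZ /= !ffunE /GRing.scale /= rmorphM /= fg -mulrA [X in _ * X]mulrC.
Qed.

Lemma conj_sign (b : bool) : ((-1) ^+ b : K)^* = (-1) ^+ b.
Proof. by rewrite rmorphXn rmorphN1. Qed.

Lemma Efac_coord (i : 'I_l) r q (a b : word m n l) : Efac K i r q (tb a) b =
  if (a i == q) && (b == subst_word a i r) then
    (-1) ^+ ((par r (+) par q) && xor_before (word_par a) i) else 0.
Proof.
rewrite Efac_tbasis; case: ifP => _ /=; rewrite !ffunE //.
by case: eqP => _; rewrite /GRing.scale /= ?mulr1 ?mulr0.
Qed.

Lemma subst_word_sym (a b : word m n l) i r q :
  (a i == q) && (b == subst_word a i r) -> (b i == r) && (a == subst_word b i q).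
Proof.
case/andP => /eqP aq /eqP ->; rewrite ffunE eqxx subst_word_same eqxx /=.
by apply/eqP/ffunP => k; rewrite ffunE -aq; case: eqP => [->|].
Qed.

(** The sign involves only the letters before i, which stay unchanged, and the parity of the matrix
    unit, which is that of its transpose. *)
Lemma adjoint_Efac (i : 'I_l) r q : adjoint (Efac K i r q) (Efac K i q r).
Proof.
apply: adjoint_basis => a b; rewrite !Efac_coord.
have -> : (b i == r) && (a == subst_word b i q) = (a i == q) && (b == subst_word a i r).
  by apply/idP/idP => /subst_word_sym.
case: ifP => [/andP[_ /eqP ->]|_]; last by rewrite rmorph0.
by rewrite conj_sign xor_before_subst ltnn addbF [par q (+) _]addbC.
Qed.

Lemma adjoint_sum (I : finType) (P : pred I) (F G : I -> 'End(T)) :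
  (forall i, P i -> adjoint (F i) (G i)) ->
  adjoint (\sum_(i | P i) F i) (\sum_(i | P i) G i).
Proof.
move=> FG u v; rewrite dotC !sum_lfunE !linear_sum rmorph_sum /=.
by apply: eq_bigr => i Pi; rewrite -dotC FG.
Qed.

Lemma adjointZ (c : K) f g : adjoint f g -> adjoint (c *: f) (c^* *: g).
Proof.
move=> fg u v; rewrite dotC !scale_lfunE !linearZ /= /GRing.scale /= rmorphM /=.
by rewrite -dotC fg.
Qed.

Lemma adjoint_Etens r q : adjoint (Etens K l r q) (Etens K l q r).
Proof. by apply: adjoint_sum => i _; apply: adjoint_Efac. Qed.

Lemma adjoint_perm_act (s : 'S_l) :
  adjoint (perm_act K m n s) (perm_act K m n s^-1%g).
Proof.
apply: adjoint_basis => a b; rewrite !perm_act_basis !ffunE.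
have -> : (a == word_perm s^-1%g b) = (b == word_perm s a).
  apply/eqP/eqP => ->; by rewrite -word_permM ?mulgV ?mulVg word_perm1.
have [->|_] := eqVneq; last by rewrite !scaler0 rmorph0.
rewrite /GRing.scale /= !mulr1 conj_sign; congr ((-1) ^+ (nat_of_bool _)).
have := perm_parity1 (word_par a); rewrite -(mulVg s) perm_parityM.
rewrite (@eq_perm_parity _ s^-1%g (word_par (word_perm s a)) _
  (@word_par_perm _ _ _ s a)).
by move/negbT; rewrite negb_add => /eqP.
Qed.

Lemma adjoint_gaudin (z : 'I_l -> K) i :
  adjoint (gaudin m n z i) (gaudin m n (fun j => (z j)^*) i).
Proof.
rewrite !gaudin_perm_act; apply: adjoint_sum => j _.
rewrite -rmorphB -fmorphV; apply: adjointZ.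
by have := adjoint_perm_act (tperm i j); rewrite tpermV.
Qed.

Lemma sing_spaceP v : reflect (forall r q : 'I_(m + n), (r < q)%N -> Etens K l r q v = 0)
  (v \in sing_space K m n l).
Proof.
apply: (iffP idP) => [vS r q rq|H].
  apply/eqP; rewrite -memv_ker; apply: subvP vS; rewrite /sing_space.
  by apply: (bigcapv_inf r) => //; apply: (bigcapv_inf q) => //; apply: subvv.
rewrite memvE; apply/subv_bigcapP => r _; apply/subv_bigcapP => q rq.
by rewrite -memvE memv_ker H.
Qed.

End HermitianForm.

Arguments dot {K m n l}.

(** * Operators commuting with the symmetric group *)

Section EfacProducts.
Variables (K : fieldType) (m n l : nat).
Local Notation T := (tpow K m n l).
Local Notation tb := (tbasis K).
Local Notation R := (perm_act K m n).
Local Notation letter := ('I_l * ('I_(m + n) * 'I_(m + n)))%type.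
Implicit Types (s : seq letter) (u : T) (A : 'End(T)) (i j : 'I_l).
Implicit Types (r q t : 'I_(m + n)).

Lemma EtensE r q u : Etens K l r q u = \sum_i Efac K i r q u.
Proof. exact: sum_lfunE. Qed.

Lemma Efac_diag_comm i r q t u : Efac K i r q (Etens K l t t u) =
  Etens K l t t (Efac K i r q u) + ((t == q)%:R - (t == r)%:R) *: Efac K i r q u.
Proof.
rewrite !EtensE linear_sum (bigD1 i) //= [in RHS](bigD1 i) //=.
rewrite addrAC; congr (_ + _); last first.
  by apply: eq_bigr => j ji; rewrite Efac_comm 1?eq_sym // addbb andbF scale1r.
rewrite !Efac_same scalerBl [q == t]eq_sym.
case: eqP => [->|_]; case: eqP => [->|_]; rewrite ?scale1r ?scale0r ?subr0 ?addr0 //.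
- by rewrite addrC subrK.
- by rewrite add0r.
- by rewrite add0r addrN.
Qed.

Lemma Etens_diag_comm r q t u : Etens K l r q (Etens K l t t u) =
  Etens K l t t (Etens K l r q u)
  + ((t == q)%:R - (t == r)%:R) *: Etens K l r q u.
Proof.
rewrite ![Etens K l r q _]EtensE scaler_sumr linear_sum -big_split /=.
by apply: eq_bigr => i _; apply: Efac_diag_comm.
Qed.

Definition efac_prod s : 'End(T) :=
  foldr (fun (x : letter) f => (Efac K x.1 x.2.1 x.2.2 \o f)%VF) \1%VF s.

Lemma efac_prod_cons x s u :
  efac_prod (x :: s) u = Efac K x.1 x.2.1 x.2.2 (efac_prod s u).
Proof. by rewrite /= comp_lfunE. Qed.

Lemma efac_prod_cat s1 s2 u :
  efac_prod (s1 ++ s2) u = efac_prod s1 (efac_prod s2 u).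
Proof.
elim: s1 => [|x s1 IH]; first by rewrite /= id_lfunE.
by rewrite cat_cons !efac_prod_cons IH.
Qed.

Definition pass_sign r q s : bool :=
  \big[addb/false]_(y <- s) ((par r (+) par q) && (par y.2.1 (+) par y.2.2)).

Lemma Efac_efac_prod i r q s u : i \notin map fst s ->
  Efac K i r q (efac_prod s u) =
  (-1) ^+ pass_sign r q s *: efac_prod s (Efac K i r q u).
Proof.
rewrite /pass_sign; elim: s => [|[j [r' q']] s IH] /=.
  by rewrite big_nil !id_lfunE scale1r.
rewrite inE negb_or => /andP[ij /IH e]; rewrite !comp_lfunE Efac_comm // e.
by rewrite linearZ /= scalerA -signr_addb big_cons.
Qed.

Lemma efac_prod_Efac i r q s u : i \notin map fst s ->
  efac_prod s (Efac K i r q u) =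
  (-1) ^+ pass_sign r q s *: Efac K i r q (efac_prod s u).
Proof.
by move=> /Efac_efac_prod->; rewrite scalerA -signr_addb addbb scale1r.
Qed.

Lemma split_letter i s : i \in map fst s -> uniq (map fst s) ->
  exists s1 s2 r q, [/\ s = s1 ++ (i, (r, q)) :: s2, i \notin map fst s1,
    i \notin map fst s2 & uniq (map fst (s1 ++ s2))].
Proof.
case/mapP => -[j [r q]] /= js -> us; move: us; case/splitPr: js => s1 s2.
rewrite map_cat /= -cat_rcons => us; exists s1, s2, r, q.
move: us; rewrite -cats1 -catA uniq_catCA /= mem_cat negb_or -map_cat.
by case/andP => /andP[? ?] ->; split.
Qed.

(** A letter at an occupied position is moved next to the one already there and merged with it, so
    the length stays the same; the scalar is a sign, or 0 if the matrix units multiply to 0. *)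
Lemma Efac_absorb_left i r q s : i \in map fst s -> uniq (map fst s) ->
  exists (c : K) s', [/\ (Efac K i r q \o efac_prod s)%VF = c *: efac_prod s',
    uniq (map fst s') & size s' = size s].
Proof.
move=> /split_letter/[apply] -[s1 [s2 [r' [q' [-> i1 i2 u12]]]]].
exists ((q == r')%:R * (-1) ^+ pass_sign r' q' s1), ((i, (r, q')) :: s1 ++ s2); split.
- apply/lfunP => u; rewrite comp_lfunE scale_lfunE efac_prod_cat !efac_prod_cons.
  rewrite efac_prod_Efac // linearZ /= Efac_same efac_prod_cat mulrC -scalerA.
  by case: eqP => _; rewrite ?scale1r ?scale0r.
- by rewrite /= map_cat mem_cat negb_or i1 i2 -map_cat.
- by rewrite /= !size_cat /= addnS.
Qed.

Lemma Efac_absorb_right i r q s : i \in map fst s -> uniq (map fst s) ->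
  exists (c : K) s', [/\ (efac_prod s \o Efac K i r q)%VF = c *: efac_prod s',
    uniq (map fst s') & size s' = size s].
Proof.
move=> /split_letter/[apply] -[s1 [s2 [r' [q' [-> i1 i2 u12]]]]].
exists ((q' == r)%:R * (-1) ^+ pass_sign r q s2), (s1 ++ (i, (r', q)) :: s2); split.
- apply/lfunP => u; rewrite comp_lfunE scale_lfunE !efac_prod_cat !efac_prod_cons.
  rewrite (@efac_prod_Efac i r q s2) // !linearZ /= Efac_same mulrC -scalerA.
  by case: eqP => _; rewrite ?scale1r ?scale0r ?linear0.
- by rewrite map_cat /= -cat1s uniq_catCA /= mem_cat negb_or i1 i2 -map_cat.
- by rewrite !size_cat.
Qed.

Definition perm_sum A : 'End(T) := \sum_w (R w^-1%g \o (A \o R w))%VF.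

Lemma perm_sumE A u : perm_sum A u = \sum_w R w^-1%g (A (R w u)).
Proof. by rewrite sum_lfunE; apply: eq_bigr => w _; rewrite !comp_lfunE. Qed.

Lemma perm_sum_is_linear : linear perm_sum.
Proof.
move=> c A B; apply/lfunP => u; rewrite add_lfunE scale_lfunE !perm_sumE.
rewrite scaler_sumr -big_split /=; apply: eq_bigr => w _.
by rewrite add_lfunE scale_lfunE linearP.
Qed.
HB.instance Definition _ :=
  GRing.isLinear.Build K 'End(T) 'End(T) _ perm_sum perm_sum_is_linear.

Lemma perm_sumZ (c : K) A : perm_sum (c *: A) = c *: perm_sum A.
Proof. exact: linearZ. Qed.

Lemma perm_sum_sum (I : finType) (P : pred I) (F : I -> 'End(T)) :
  perm_sum (\sum_(k | P k) F k) = \sum_(k | P k) perm_sum (F k).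
Proof. exact: linear_sum. Qed.

Lemma perm_sum_conj (t : 'S_l) A : perm_sum (R t^-1%g \o (A \o R t))%VF = perm_sum A.
Proof.
apply/lfunP => u; rewrite !perm_sumE [RHS](reindex_inj (mulgI t)) /=.
apply: eq_bigr => w _; rewrite !comp_lfunE invMg.
by rewrite (perm_actM w^-1%g t^-1%g) (perm_actM t w).
Qed.

(** [Etens] commutes with S_l, so it can be moved inside each conjugate. *)
Lemma Etens_perm_sum r q A :
  (Etens K l r q \o perm_sum A)%VF = \sum_i perm_sum (Efac K i r q \o A)%VF.
Proof.
apply/lfunP => u; rewrite comp_lfunE [RHS]sum_lfunE perm_sumE linear_sum /=.
rewrite (eq_bigr _ (fun i _ => perm_sumE _ u)) exchange_big.
apply: eq_bigr => w _ /=; rewrite -perm_act_Etens EtensE linear_sum.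
by apply: eq_bigr => i _; rewrite comp_lfunE.
Qed.

Lemma perm_sum_Etens r q A :
  (perm_sum A \o Etens K l r q)%VF = \sum_i perm_sum (A \o Efac K i r q)%VF.
Proof.
apply/lfunP => u; rewrite comp_lfunE [RHS]sum_lfunE perm_sumE.
rewrite (eq_bigr _ (fun i _ => perm_sumE _ u)) exchange_big.
apply: eq_bigr => w _ /=; rewrite perm_act_Etens EtensE !linear_sum.
by apply: eq_bigr => i _; rewrite comp_lfunE.
Qed.

Lemma perm_act_efac_prod (t : 'S_l) s u : {in map fst s, t =1 id} ->
  R t (efac_prod s u) = efac_prod s (R t u).
Proof.
elim: s u => [|[i [r q]] s IH] u ts; first by rewrite !id_lfunE.
have ti : t i = i by apply: ts; rewrite inE eqxx.
rewrite !efac_prod_cons /= -{1}ti perm_act_Efac IH // => j js.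
by apply: ts; rewrite inE js orbT.
Qed.

(* Conjugation by the transposition of i and j, which fixes all positions in s. *)
Lemma perm_sum_position i j r q s : i \notin map fst s -> j \notin map fst s ->
  perm_sum (Efac K i r q \o efac_prod s)%VF =
  perm_sum (Efac K j r q \o efac_prod s)%VF.
Proof.
move=> iN jN; rewrite -[RHS](perm_sum_conj (tperm i j)).
congr (perm_sum _); apply/lfunP => u; rewrite !comp_lfunE -perm_act_efac_prod.
  by rewrite -perm_act_Efac perm_actVK tpermR.
move=> k ks; rewrite tpermD //; [apply: contraNneq iN|apply: contraNneq jN] => -> //.
Qed.

Definition word_unit (a b : word m n l) : 'End(T) :=
  linfun (lin_ext (fun c => if c == a then tb b else 0)).

Lemma word_unit_basis (a b c : word m n l) :
  word_unit a b (tb c) = if c == a then tb b else 0.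
Proof. by rewrite lfunE /= lin_ext_basis. Qed.

Lemma word_unitE (a b : word m n l) u : word_unit a b u = (u a : K) *: tb b.
Proof.
rewrite {1}(tbasis_sum u) linear_sum (bigD1 a) //= big1 ?addr0 => [|c ca].
  by rewrite linearZ /= word_unit_basis eqxx.
by rewrite linearZ /= word_unit_basis (negPf ca) scaler0.
Qed.

Lemma efac_prod_word (a b c : word m n l) (ps : seq 'I_l) : uniq ps ->
  let P := efac_prod [seq (i, (b i, a i)) | i <- ps] in
  if all (fun i => c i == a i) ps then
    exists e : bool, P (tb c) = (-1) ^+ e *: tb [ffun k => if k \in ps then b k else c k]
  else P (tb c) = 0.
Proof.
elim: ps => [|i ps IH] /=.
  move=> _; exists false; rewrite id_lfunE scale1r; congr (tb _).
  by apply/ffunP => k; rewrite ffunE.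
case/andP => ips /IH /= {IH}; case: ifP => [_ [e]|_]; last first.
  by rewrite andbF comp_lfunE => ->; rewrite linear0.
rewrite andbT comp_lfunE => ->; rewrite linearZ /= Efac_tbasis ffunE (negPf ips).
case: (c i == a i); last by rewrite scaler0.
rewrite scalerA -signr_addb; eexists; congr (_ *: tb _).
apply/ffunP => k; rewrite !ffunE inE.
by case: eqP => [->|].
Qed.

(** One matrix unit at every position maps the word a to b up to a sign, read off on a, and kills
    all other words. *)
Lemma word_unit_efac_prod (a b : word m n l) : exists (d : K) s,
  word_unit a b = d *: efac_prod s /\ uniq (map fst s).
Proof.
pose s := [seq (i, (b i, a i)) | i <- enum 'I_l].
have := @efac_prod_word a b a _ (enum_uniq 'I_l).
rewrite /= -/s; case: ifP => [_ [e He]|/allP]; last by case=> i _.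
exists ((-1) ^+ e), s; split; last by rewrite -map_comp map_id enum_uniq.
apply: eq_lfun_tbasis => c; rewrite word_unit_basis scale_lfunE.
case: eqP => [->|ca].
  rewrite He scalerA -signr_addb addbb scale1r; congr (tb _).
  by apply/ffunP => k; rewrite ffunE mem_enum.
have := @efac_prod_word a b c _ (enum_uniq 'I_l).
rewrite /= -/s; case: ifP => [/allP H|_ ->]; last by rewrite scaler0.
by case: ca; apply/ffunP => k; apply/eqP/H; rewrite mem_enum.
Qed.

End EfacProducts.

(** * Joint eigenvectors in the singular space *)

Section SingularLine.
Variables (K : numClosedFieldType) (m n l : nat).
Local Notation T := (tpow K m n l).
Local Notation Sing := (sing_space K m n l).
Implicit Types (u v : T) (A B : 'End(T)) (i j : 'I_l).
Implicit Types (r q t : 'I_(m + n)).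

Lemma sing_space_diag t u : u \in Sing -> Etens K l t t u \in Sing.
Proof.
move=> /sing_spaceP uS; apply/sing_spaceP => r q rq.
by rewrite Etens_diag_comm uS // linear0 scaler0 addr0.
Qed.

Lemma sing_space_perm_act (w : 'S_l) u : u \in Sing -> perm_act K m n w u \in Sing.
Proof.
move=> /sing_spaceP uS; apply/sing_spaceP => r q rq.
by rewrite -perm_act_Etens uS // linear0.
Qed.

Lemma sing_space_gaudin (z : 'I_l -> K) i u : u \in Sing -> gaudin m n z i u \in Sing.
Proof.
move=> uS; rewrite gaudin_perm_act sum_lfunE rpred_sum // => j _.
by rewrite scale_lfunE rpredZ // sing_space_perm_act.
Qed.

Section Weight.
Variables (v : T) (mu : 'I_(m + n) -> K).
Hypothesis vS : v \in Sing.
Hypothesis v_weight : forall t, Etens K l t t v = mu t *: v.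

(* A acts on v as a scalar modulo the orthogonal complement of Sing. *)
Definition scalar_on A := exists d : K, forall u, u \in Sing ->
  dot u (A v) = d * dot u v.

Lemma scalar_on0 : scalar_on 0.
Proof. by exists 0 => u _; rewrite zero_lfunE linear0 mul0r. Qed.

Lemma scalar_onD A B : scalar_on A -> scalar_on B -> scalar_on (A + B).
Proof.
move=> [d Hd] [e He]; exists (d + e) => u uS.
by rewrite add_lfunE linearD /= Hd // He // mulrDl.
Qed.

Lemma scalar_onZ (c : K) A : scalar_on A -> scalar_on (c *: A).
Proof.
move=> [d Hd]; exists (c * d) => u uS.
by rewrite scale_lfunE dotZr Hd // mulrA.
Qed.

Lemma scalar_on_sum (I : finType) (P : pred I) (F : I -> 'End(T)) :
  (forall k, P k -> scalar_on (F k)) -> scalar_on (\sum_(k | P k) F k).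
Proof. by apply: big_ind; [apply: scalar_on0 | apply: scalar_onD]. Qed.

Lemma scalar_on_lower r q A : (q < r)%N -> scalar_on (Etens K l r q \o A)%VF.
Proof.
move=> qr; exists 0 => u /sing_spaceP uS.
by rewrite comp_lfunE mul0r -adjoint_Etens uS // dot0l.
Qed.

Lemma scalar_on_raise r q A : (r < q)%N -> scalar_on (A \o Etens K l r q)%VF.
Proof.
move=> rq; exists 0 => u uS; rewrite comp_lfunE.
by have /sing_spaceP -> := vS; rewrite // !linear0 mul0r.
Qed.

Lemma scalar_on_diag t A : scalar_on A -> scalar_on (Etens K l t t \o A)%VF.
Proof.
case=> d Hd; exists (d * mu t) => u uS.
rewrite comp_lfunE -adjoint_Etens Hd ?sing_space_diag // adjoint_Etens v_weight.
by rewrite dotZr mulrA.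
Qed.

(** Every position outside s contributes A; there is at least one, namely i, so one can divide by
    their number. *)
Lemma scalar_on_positions (s : seq 'I_l) i (F : 'I_l -> 'End(T)) A :
    i \notin s -> (forall j, j \in s -> scalar_on (F j)) ->
    (forall j, j \notin s -> F j = A) ->
  scalar_on (\sum_j F j) -> scalar_on A.
Proof.
move=> iN Fs FA; rewrite (bigID [pred j | j \in s]) /=.
rewrite [X in _ + X](eq_bigr (fun=> A)) // sumr_const => H.
set k := #|_| in H; have k0 : (k%:R : K) != 0.
  by rewrite pnatr_eq0 -lt0n; apply/card_gt0P; exists i.
have := scalar_onD H (scalar_onZ (-1) (@scalar_on_sum _ (mem s) F Fs)).
rewrite scaleN1r addrAC addrN add0r => /(scalar_onZ k%:R^-1).
by rewrite -scaler_nat scalerA mulVf // scale1r.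
Qed.

(* Multiplying the symmetrization of a shorter product by the sum over all
   positions of the next letter gives the wanted symmetrization, with a positive
   multiplicity, plus symmetrizations of shorter products.  A lowering or diagonal
   letter is put on the left, where it acts on Sing through its adjoint, and a
   raising one on the right, where it kills v. *)
Lemma scalar_on_efac_prod (s : seq ('I_l * ('I_(m + n) * 'I_(m + n)))) :
  uniq (map fst s) -> scalar_on (perm_sum (efac_prod K s)).
Proof.
have [k] := ubnP (size s); elim: k s => // k IH [|[i [r q]] s] sk us.
  exists l`!%:R => u uS; rewrite perm_sumE.
  rewrite (eq_bigr (fun=> v)) => [|w _]; last by rewrite /= id_lfunE perm_actVK.
  by rewrite sumr_const card_Sn -scaler_nat dotZr.
have /= /andP[iN us'] := us.
have IHs c (s' : seq ('I_l * ('I_(m + n) * 'I_(m + n)))) : uniq (map fst s') ->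
    size s' = size s -> scalar_on (perm_sum (c *: efac_prod K s')).
  by move=> u' e; rewrite perm_sumZ; apply/scalar_onZ/IH; rewrite // e.
have left : scalar_on (Etens K l r q \o perm_sum (efac_prod K s))%VF ->
    scalar_on (perm_sum (Efac K i r q \o efac_prod K s)%VF).
  rewrite Etens_perm_sum; apply: (scalar_on_positions iN) => j js.
    by have [c [s' [-> ? ?]]] := Efac_absorb_left K r q js us'; apply: IHs.
  by rewrite (perm_sum_position K r q js iN).
have [rq|qr|/val_inj e] := ltngtP r q; last 2 first.
- by apply/left/scalar_on_lower.
- by rewrite e in left *; apply/left/scalar_on_diag/IH.
have := scalar_on_raise (perm_sum (efac_prod K s)) rq; rewrite perm_sum_Etens.
(* The sign of moving the raising letter from the right end to the left does not depend on its
   position j. *)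
pose c : K := (-1) ^+ pass_sign r q s.
have cE j : j \notin map fst s -> (efac_prod K s \o Efac K j r q)%VF =
    c *: (Efac K j r q \o efac_prod K s)%VF.
  move=> js; apply/lfunP => u.
  by rewrite scale_lfunE !comp_lfunE efac_prod_Efac.
have cc : c * c = 1 by rewrite -signr_addb addbb.
move=> H; rewrite -[perm_sum _]scale1r -cc -scalerA; apply: scalar_onZ.
apply: (scalar_on_positions iN) H => j js.
  by have [d [s' [-> ? ?]]] := Efac_absorb_right K r q js us'; apply: IHs.
by rewrite cE // perm_sumZ (perm_sum_position K r q js iN).
Qed.

End Weight.

(** The operator A sends w v1 to w v2 for all w, so its symmetrization sends v1 to l! v2. It also
    acts on v1 as a scalar d modulo the complement of Sing; thus v2 - (d / l!) v1 is singular and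
    orthogonal to itself. *)
Lemma sing_eigen_line (z c : 'I_l -> K) v1 v2 (mu : 'I_(m + n) -> K) :
    injective z -> v1 \in Sing -> v2 \in Sing -> v1 != 0 ->
    (forall t, Etens K l t t v1 = mu t *: v1) ->
    (forall i, gaudin m n z i v1 = c i *: v1) ->
    (forall i, gaudin m n z i v2 = c i *: v2) ->
  v2 \in <[v1]>%VS.
Proof.
move=> z_inj v1S v2S v10 v1w Hv1 Hv2.
have [h Hh] := matcoef_intertwine z_inj v10 Hv1 Hv2.
pose A : 'End(T) := \sum_b \sum_b' h b b' *: word_unit K b' b.
have AE w : A (perm_act K m n w v1) = perm_act K m n w v2.
  rewrite /A sum_lfunE [RHS](tbasis_sum); apply: eq_bigr => b _.
  rewrite sum_lfunE Hh scaler_suml; apply: eq_bigr => b' _.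
  by rewrite scale_lfunE word_unitE scalerA.
have [d Hd] : scalar_on v1 (perm_sum A).
  rewrite perm_sum_sum; apply: scalar_on_sum => b _.
  rewrite perm_sum_sum; apply: scalar_on_sum => b' _.
  have [e [s [-> us]]] := word_unit_efac_prod K b' b.
  by rewrite !perm_sumZ; do 2!apply: scalar_onZ; apply: (scalar_on_efac_prod v1S v1w).
have {}AE : perm_sum A v1 = l`!%:R *: v2.
  rewrite perm_sumE (eq_bigr (fun=> v2)) => [|w _]; last by rewrite AE perm_actVK.
  by rewrite sumr_const card_Sn scaler_nat.
have f0 : (l`!%:R : K) != 0 by rewrite pnatr_eq0 -lt0n fact_gt0.
apply/vlineP; exists (l`!%:R^-1 * d).
apply/eqP; rewrite -subr_eq0; apply/eqP/dot_eq0.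
set u := v2 - _; have uS : u \in Sing by rewrite memvB // memvZ.
rewrite {2}/u linearB /= dotZr.
have := Hd u uS; rewrite AE dotZr => /(congr1 (fun x => l`!%:R^-1 * x)).
by rewrite mulKf // mulrA => ->; rewrite subrr.
Qed.

End SingularLine.

(** * Cyclicity *)

Section JointEigenvectors.
Variables (K : numClosedFieldType) (V : vectType K).
Implicit Types (N W : {vspace V}) (f g : 'End(V)).

Lemma end_eigenvector N f : N != 0%VS -> (f @: N <= N)%VS ->
  exists c v, [/\ v \in N, v != 0 & f v = c *: v].
Proof.
move=> N0 fN; have dN : (0 < \dim N)%N by rewrite lt0n dimv_eq0.
have [c /eigenvalueP[x xA x0]] := eigenvalue_closed (mx_on N N f) dN.
have bN k : (vbasis N)`_k \in N.
  have [kN|kN] := ltnP k (size (vbasis N)); first exact/vbasis_mem/mem_nth.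
  by rewrite nth_default ?mem0v.
exists c, (\sum_i x 0 i *: (vbasis N)`_i); split.
- by apply: rpred_sum => i _; apply: rpredZ.
- apply: contraNneq x0 => /(freeP (basis_free (vbasisP N))) H.
  by apply/eqP/rowP => i; rewrite mxE H.
rewrite linear_sum scaler_sumr.
have fb (i : 'I_(\dim N)) : f (vbasis N)`_i = \sum_j mx_on N N f i j *: (vbasis N)`_j.
  rewrite {1}[f _](coord_vbasis (subvP fN _ (memv_img f (bN i)))).
  by apply: eq_bigr => j _; rewrite mxE.
under eq_bigr => i _ do rewrite linearZ /= fb scaler_sumr.
rewrite exchange_big; apply: eq_bigr => j _ /=.
have /rowP/(_ j) := xA; rewrite !mxE => xAj; rewrite [RHS]scalerA -xAj.
by rewrite scaler_suml; apply: eq_bigr => i _; rewrite scalerA.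
Qed.

Lemma joint_eigenvector N (fs : seq 'End(V)) : N != 0%VS ->
    {in fs, forall f, (f @: N <= N)%VS} ->
    {in fs &, forall f g, forall u, f (g u) = g (f u)} ->
  exists v, [/\ v \in N, v != 0 & {in fs, forall f, exists c, f v = c *: v}].
Proof.
elim: fs N => [|f fs IH] N N0 fN fC.
  by exists (vpick N); rewrite memv_pick vpick0.
have [c [v [vN v0 fv]]] := end_eigenvector N0 (fN f (mem_head _ _)).
pose N' := (N :&: lker (f - c *: \1%VF))%VS.
have memN' u : (u \in N') = (u \in N) && (f u == c *: u).
  by rewrite memv_cap memv_ker add_lfunE opp_lfunE scale_lfunE id_lfunE subr_eq0.
have N'0 : N' != 0%VS.
  apply: contraNneq v0 => N'0.
  by rewrite -memv0 -N'0 memN' vN fv eqxx.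
have [|g h gfs hfs|w [wN w0 wfs]] := IH N' N'0.
- move=> g gfs; apply/subvP => _ /memv_imgP[u + ->].
  rewrite !memN' => /andP[uN /eqP fu]; apply/andP; split.
    by apply: (subvP (fN g _)); rewrite ?memv_img // inE gfs orbT.
  by rewrite fC ?fu ?linearZ // !inE ?eqxx ?gfs ?orbT.
- by apply: fC; rewrite inE ?gfs ?hfs orbT.
exists w; split=> //; first by move: wN; rewrite memN' => /andP[].
move=> g; rewrite inE => /predU1P[->|]; last exact: wfs.
by exists c; move: wN; rewrite memN' => /andP[_ /eqP].
Qed.

Lemma eigenvalue_seq f : exists s : seq K, forall c v,
  v != 0 -> f v = c *: v -> c \in s.
Proof.
have [s Hs] := closed_field_poly_normal (char_poly (mx_on fullv fullv f)).
exists s => c v v0 fv; rewrite -root_prod_XsubC.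
have -> : \prod_(x <- s) ('X - x%:P) = char_poly (mx_on fullv fullv f).
  by rewrite Hs (monicP (char_poly_monic _)) scale1r.
rewrite -eigenvalue_root_char; apply/eigenvalueP.
exists (\row_i coord (vbasis fullv) i v).
  apply/rowP => j; rewrite !mxE.
  have <- : coord (vbasis fullv) j (f v) = c * coord (vbasis fullv) j v.
    by rewrite fv linearZ.
  rewrite [in RHS](coord_vbasis (memvf v)) !linear_sum.
  by apply: eq_bigr => i _; rewrite !linearZ !mxE.
apply: contraNneq v0 => /rowP H; apply/eqP.
rewrite (coord_vbasis (memvf v)) big1 // => i _.
by have := H i; rewrite !mxE => ->; rewrite scale0r.
Qed.

Section Krylov.
Variables (I : finType) (fs : I -> 'End(V)) (w : V).

Fixpoint krylov t : {vspace V} :=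
  if t is t'.+1 then (krylov t' + \sum_i fs i @: krylov t')%VS else <[w]>%VS.

Lemma krylov_stable : exists t, forall i, (fs i @: krylov t <= krylov t)%VS.
Proof.
have kS t : (krylov t <= krylov t.+1)%VS by apply: addvSl.
suff [t e] : exists t, krylov t.+1 = krylov t.
  exists t => i; rewrite -{2}e; apply: (subv_trans _ (addvSr _ _)).
  by apply: (sumv_sup i).
have H t : (exists s, krylov s.+1 = krylov s) \/ (t <= \dim (krylov t))%N.
  elim: t => [|t [IH|IH]]; [by right|by left|].
  have [e|ne] := eqVneq (krylov t.+1) (krylov t); first by left; exists t.
  right; apply: (leq_ltn_trans IH); rewrite ltn_neqAle dimvS // andbT.
  by apply: contraNneq ne => e; rewrite eq_sym eqEdim kS e leqnn.
have [//|] := H (\dim {:V}).+1.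
by move/leq_trans/(_ (dimvS (subvf _))); rewrite ltnn.
Qed.

Lemma krylov_ind (P : V -> Prop) : P w ->
    (forall (c : K) u v, P u -> P v -> P (c *: u + v)) ->
    (forall i u, P u -> P (fs i u)) ->
  forall t u, u \in krylov t -> P u.
Proof.
move=> Pw PD Pf.
have P0 : P 0 by rewrite -(addNr w) -scaleN1r; apply: (PD).
elim=> [|t IH] u /=.
  by case/vlineP=> c ->; rewrite -[_ *: _]addr0; apply: (PD).
case/memv_addP=> u1 /IH Pu1 [_ /memv_sumP[us us_in ->] ->].
rewrite -[u1]scale1r; apply: (PD) => //.
apply: (big_ind P) => // [x y Px Py|i _].
  by rewrite -[x]scale1r; apply: (PD).
by have /memv_imgP[x /IH Px ->] := us_in i isT; apply: Pf.
Qed.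

End Krylov.
End JointEigenvectors.

Lemma fresh_scalar (K : numDomainType) (s : seq K) : exists t, t \notin s.
Proof.
have u : uniq [seq (k%:R : K) | k <- iota 0 (size s).+1].
  by rewrite map_inj_uniq ?iota_uniq // => i j /eqP; rewrite eqr_nat => /eqP.
have [/hasP[t _ ts]|/hasPn H] :=
  boolP (has [predC s] [seq (k%:R : K) | k <- iota 0 (size s).+1]).
  by exists t.
have : (size [seq (k%:R : K) | k <- iota 0 (size s).+1] <= size s)%N.
  by apply: uniq_leq_size => // t /H; rewrite negbK.
by rewrite size_map size_iota ltnn.
Qed.

(** * Commutativity of the Gaudin Hamiltonians *)

Section GaudinCommute.
Variables (K : fieldType) (m n l : nat) (z : 'I_l -> K).
Hypothesis z_inj : injective z.
Local Notation H := (gaudin m n z).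
Local Notation R := (perm_act K m n).

Let F i j u k p :=
  ((z i - z k)^-1 * (z j - z p)^-1) *: R (tperm i k * tperm j p)%g u.

Lemma gaudin_gaudin i j u :
  H i (H j u) = \sum_(k | k != i) \sum_(p | p != j) F i j u k p.
Proof.
rewrite !gaudin_perm_act sum_lfunE; apply: eq_bigr => k _.
rewrite scale_lfunE sum_lfunE linear_sum scaler_sumr; apply: eq_bigr => p _.
rewrite scale_lfunE linearZ /= scalerA; congr (_ *: _).
by rewrite -perm_actM.
Qed.

(** The products are sorted into the square of one transposition, the 3-cycles on i, j, k, and pairs
    of disjoint transpositions. *)
Lemma gaudin_gaudin_split i j u : i != j -> H i (H j u) = F i j u j i +
  \sum_(k | (k != i) && (k != j)) (F i j u j k + F i j u k i + F i j u k k) +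
  \sum_(k | (k != i) && (k != j)) \sum_(p | [&& p != i, p != j & p != k]) F i j u k p.
Proof.
move=> ij; rewrite gaudin_gaudin (bigD1 j) 1?eq_sym //= (bigD1 i) //=.
rewrite -!addrA; congr (_ + _); rewrite !big_split /= -!addrA.
congr (_ + _); first by apply: eq_bigl => k; rewrite andbC.
rewrite -!big_split /=; apply: eq_bigr => k /andP[ki kj].
rewrite (bigD1 i) //= (bigD1 k) /= ?ki ?kj //; congr (_ + (_ + _)).
by apply: eq_bigl => p; rewrite andbA [(p != i) && _]andbC.
Qed.

Lemma tperm_cycle (i j k : 'I_l) : i != j -> k != i -> k != j ->
  (tperm i j * tperm j k = tperm i k * tperm j i)%g.
Proof.
move=> ij ki kj; rewrite [tperm j k]tpermC.
have -> : tperm i k = (tperm j k ^ tperm i j)%g.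
  by rewrite tpermJ tpermR tpermD // eq_sym.
by rewrite conjgE tpermV [tperm j i]tpermC -!mulgA tperm2 mulg1 tpermC [tperm k j]tpermC.
Qed.

(** Two of the three products are the same 3-cycle, and partial fractions turn the sum of their
    coefficients into that of the third. The result is symmetric in i and j. *)
Lemma gaudin_triple i j k u : i != j -> k != i -> k != j ->
  F i j u j k + F i j u k i + F i j u k k = ((z i - z k)^-1 * (z j - z k)^-1) *:
    (R (tperm i j * tperm j k)%g u + R (tperm j i * tperm i k)%g u).
Proof.
move=> ij ki kj; rewrite /F -(tperm_cycle ij ki kj) -scalerDl scalerDr.
have -> : (tperm i k * tperm j k = tperm j i * tperm i k)%g.
  by rewrite [tperm j k]tpermC tperm_cycle // 1?eq_sym // tpermC [tperm k i]tpermC.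
congr (_ *: _ + _ *: _).
have zz (p q : 'I_l) : p != q -> z p - z q != 0 by rewrite subr_eq0 (inj_eq z_inj).
field; rewrite !zz // eq_sym //.
Qed.

Lemma gaudinC i j u : H i (H j u) = H j (H i u).
Proof.
have [->//|ij] := eqVneq i j; have ji : j != i by rewrite eq_sym.
apply: etrans (gaudin_gaudin_split u ij) _.
apply: etrans _ (esym (gaudin_gaudin_split u ji)).
apply: (f_equal2 +%R); first apply: (f_equal2 +%R).
- by rewrite /F mulrC [tperm j i]tpermC.
- apply: eq_big => k; first by rewrite andbC.
  case/andP => ki kj; apply: etrans (gaudin_triple u ij ki kj) _.
  apply: etrans _ (esym (gaudin_triple u ji kj ki)).
  by rewrite mulrC [X in _ *: X]addrC.
- rewrite (exchange_big_dep (fun p => (p != j) && (p != i))) /=; last first.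
    by move=> k p _ /and3P[-> ->].
  apply: eq_bigr => p /andP[pj pi]; apply: eq_big => k.
    by rewrite pi pj /= [p == k]eq_sym; case: (k == i) (k == j) (k == p) => [] [] [].
  case/andP => /andP[ki kj] /and3P[_ _ pk].
  rewrite /F mulrC conjgC tpermJ !tpermD // 1?eq_sym //.
Qed.

End GaudinCommute.

(** * Generic vectors and orthogonal complements *)

Section Cyclic.
Variables (K : numClosedFieldType) (m n l : nat).
Local Notation T := (tpow K m n l).
Local Notation Sing := (sing_space K m n l).
Implicit Types (z c : 'I_l -> K) (u v w : T).

Lemma gaudinE z i u :
  gaudin m n z i u = \sum_(j | j != i) (z i - z j)^-1 *: perm_act K m n (tperm i j) u.
Proof.
rewrite gaudin_perm_act sum_lfunE.
by apply: eq_bigr => j _; rewrite scale_lfunE.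
Qed.

Lemma gaudin_Etens z i (r q : 'I_(m + n)) u :
  gaudin m n z i (Etens K l r q u) = Etens K l r q (gaudin m n z i u).
Proof.
rewrite !gaudinE linear_sum; apply: eq_bigr => j _.
by rewrite linearZ /= perm_act_Etens.
Qed.

Definition joint_eigenspace z c : {vspace T} :=
  (Sing :&: \bigcap_i lker (gaudin m n z i - c i *: \1%VF))%VS.

Lemma joint_eigenspaceP z c u :
  reflect (u \in Sing /\ forall i, gaudin m n z i u = c i *: u)
    (u \in joint_eigenspace z c).
Proof.
rewrite memv_cap; apply: (iffP andP) => -[uS H]; split=> //.
  move=> i; apply/eqP; rewrite -subr_eq0; move: H; rewrite memvE.
  move=> /subv_bigcapP/(_ i isT); rewrite -memvE memv_ker.
  by rewrite add_lfunE opp_lfunE scale_lfunE id_lfunE.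
rewrite memvE; apply/subv_bigcapP => i _; rewrite -memvE memv_ker.
by rewrite add_lfunE opp_lfunE scale_lfunE id_lfunE H subrr.
Qed.

(** The joint eigenspace is stable under the commuting E_{t,t}, so it contains a weight vector v1,
    and [sing_eigen_line] places v and v' on its line. *)
Lemma joint_eigen_line z c v v' : injective z ->
    v \in Sing -> v != 0 -> (forall i, gaudin m n z i v = c i *: v) ->
    v' \in Sing -> (forall i, gaudin m n z i v' = c i *: v') ->
  v' \in <[v]>%VS.
Proof.
move=> z_inj vS v0 Hv v'S Hv'.
pose W := joint_eigenspace z c.
have memW u := joint_eigenspaceP z c u.
have W0 : W != 0%VS.
  apply: contraNneq v0 => W0; rewrite -memv0 -W0; exact/memW.
pose fs := [seq Etens K l t t | t : 'I_(m + n)].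
have [||v1 [/memW[v1S Hv1] v10 Ev1]] := joint_eigenvector (fs := fs) W0.
- move=> _ /mapP[t _ ->]; apply/subvP => _ /memv_imgP[u /memW[uS Hu] ->].
  apply/memW; split=> [|i]; first exact: sing_space_diag.
  by rewrite -linearZ -Hu gaudin_Etens.
- move=> _ _ /mapP[t _ ->] /mapP[t' _ ->] u.
  by rewrite Etens_diag_comm addrN scale0r addr0.
have /fin_all_exists[mu Hmu] t : exists a, Etens K l t t v1 = a *: v1.
  by apply: Ev1; apply: map_f; rewrite mem_enum.
have /vlineP[a va] := sing_eigen_line z_inj v1S vS v10 Hmu Hv1 Hv.
have /vlineP[b vb] := sing_eigen_line z_inj v1S v'S v10 Hmu Hv1 Hv'.
have a0 : a != 0 by apply: contraNneq v0 => a0; rewrite va a0 scale0r.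
by apply/vlineP; exists (b / a); rewrite vb va scalerA divfK.
Qed.

Lemma generic_vector (vs : seq T) : {subset vs <= Sing} ->
  exists2 w, w \in Sing & {in vs, forall v, v != 0 -> dot v w != 0}.
Proof.
elim: vs => [|v vs IH] vsS; first by exists 0; rewrite ?mem0v.
have [|w wS Hw] := IH; first by move=> u uvs; apply: vsS; rewrite inE uvs orbT.
have vS : v \in Sing by apply: vsS; rewrite mem_head.
(* The excluded values are those at which [dot u (w + t *: v)] vanishes when [dot u v] is nonzero.
   If [dot u v] is 0 the quotient is 0 by convention, and no t is bad. *)
have [t] := fresh_scalar (0 - dot v w / dot v v :: [seq - dot u w / dot u v | u <- vs]).
rewrite inE negb_or sub0r -mulNr => /andP[tv tvs].
have tP u : u != 0 -> dot u v != 0 \/ dot u w != 0 -> t != - dot u w / dot u v ->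
    dot u (w + t *: v) != 0.
  move=> u0 uvw; apply: contraNneq => /eqP.
  rewrite linearD /= dotZr addrC addr_eq0 => /eqP e.
  have [uv|uv] := eqVneq (dot u v) 0; last by rewrite -e mulfK.
  by case: uvw; rewrite ?uv ?eqxx // => /eqP[]; apply/eqP; rewrite -oppr_eq0 -e uv mulr0.
exists (w + t *: v); first by rewrite memvD ?memvZ.
move=> u; rewrite inE => /predU1P[->|uvs] u0; apply: tP => //.
- by left; apply: contraNneq u0 => /dot_eq0->.
- by right; apply: Hw.
- by apply: contraNneq tvs => ->; apply/mapP; exists u.
Qed.

Lemma dot_complement (Y W : {vspace T}) : (\dim Y < \dim W)%N ->
  exists2 N : {vspace T}, N != 0%VS & forall v,
    v \in N <-> v \in W /\ forall y, y \in Y -> dot v y = 0.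
Proof.
(* [dot] is linear in its second argument only, so v is put there and the condition is turned around
   by [dotC]. *)
move=> YW; pose phi (v : T) : 'rV[K]_(\dim Y) := \row_k dot (vbasis Y)`_k v.
have phi_lin : linear phi.
  by move=> a u v; apply/rowP => k; rewrite !mxE linearP.
pose phiL := GRing.isLinear.Build K T 'rV[K]_(\dim Y) _ phi phi_lin.
pose Phi : {linear T -> 'rV[K]_(\dim Y)} := HB.pack phi phiL.
pose f := linfun Phi.
exists (W :&: lker f)%VS.
  rewrite -dimv_eq0 -lt0n -(ltn_add2r (\dim (f @: W))) limg_ker_dim add0n.
  apply: leq_ltn_trans YW; apply: (leq_trans (dimvS (subvf _))).
  by rewrite dimvf /dim /= mul1n.
have fE v : f v = phi v by rewrite /f lfunE.
move=> v; rewrite memv_cap memv_ker fE; split=> [/andP[vW vY]|[vW vY]].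
  split=> //.
  move=> y yY; rewrite (coord_vbasis yY) linear_sum big1 // => k _.
  rewrite /= dotZr dotC; have /eqP/rowP/(_ k) := vY; rewrite !mxE => ->.
  by rewrite rmorph0 mulr0.
rewrite vW; apply/eqP/rowP => k; rewrite !mxE dotC vY ?rmorph0 //.
by apply/vbasis_mem/mem_nth; rewrite size_tuple.
Qed.

(** There are finitely many candidate eigenvalue tuples and each joint eigenspace is at most a line,
    so one vector for each tuple suffices. *)
Lemma gaudin_generic_vector z : injective z -> exists2 w, w \in Sing &
  forall v c, v \in Sing -> v != 0 -> (forall i, gaudin m n z i v = c i *: v) ->
    dot v w != 0.
Proof.
move=> z_inj.
have /fin_all_exists[S HS] i := eigenvalue_seq (gaudin m n z i).
pose s := flatten [seq S i | i <- enum 'I_l].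
pose W := joint_eigenspace z.
have memW c u := joint_eigenspaceP z c u.
pose cs (j : {ffun 'I_l -> 'I_(size s)}) i := s`_(j i).
(* [vpick] returns 0 for tuples that do not occur; [generic_vector] demands nothing of zero
   vectors. *)
pose vs := [seq vpick (W (cs j)) | j : {ffun 'I_l -> 'I_(size s)}].
have [|w wS Hw] := @generic_vector vs.
  by move=> _ /mapP[j _ ->]; have /memW[] := memv_pick (W (cs j)).
exists w => // v c vS v0 Hv.
have /fin_all_exists[j Hj] i : exists k : 'I_(size s), c i = s`_k.
  have cs_i : c i \in s.
    apply/flattenP; exists (S i); first by apply: map_f; rewrite mem_enum.
    exact: HS v0 (Hv i).
  have := cs_i; rewrite -index_mem => lt.
  by exists (Ordinal lt); rewrite nth_index.
pose f : {ffun 'I_l -> 'I_(size s)} := [ffun i => j i].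
have vW : v \in W (cs f) by apply/memW; split=> // i; rewrite Hv Hj /cs ffunE.
have W0 : vpick (W (cs f)) != 0.
  by rewrite vpick0; apply: contraNneq v0 => W0; rewrite -memv0 -W0.
have /memW[pS Hp] := memv_pick (W (cs f)).
have /vlineP[a e] : vpick (W (cs f)) \in <[v]>%VS.
  by apply: (joint_eigen_line z_inj vS v0 _ pS Hp) => i; rewrite Hv Hj /cs ffunE.
suff /Hw/(_ W0) : vpick (W (cs f)) \in vs.
  apply: contraNneq => vw.
  by rewrite e dotC dotZr dotC vw rmorph0 mulr0 rmorph0.
by apply/mapP; exists f; rewrite ?mem_enum.
Qed.

Lemma conj_inj z : injective z -> injective (fun i => (z i)^*).
Proof. by move=> z_inj i j /(inv_inj conjCK)/z_inj. Qed.

(** Were the span Y of the orbit of w smaller than Sing, its complement in Sing would be nonzero and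
    stable under the adjoints, so it would contain a joint eigenvector of them orthogonal to w. *)
Lemma gaudin_cyclic z : injective z ->
  exists2 w, w \in Sing & exists t, (Sing <= krylov (gaudin m n z) w t)%VS.
Proof.
move=> z_inj; have zc_inj := conj_inj z_inj.
have [w wS Hw] := gaudin_generic_vector zc_inj.
exists w => //; have [t Ht] := krylov_stable (gaudin m n z) w.
exists t.
set Y := krylov _ _ _ in Ht *.
have wY : w \in Y.
  rewrite /Y; elim: {Ht Y} t => [|t IH] /=; first exact: memv_line.
  exact: (subvP (addvSl _ _)).
have YS : (Y <= Sing)%VS.
  apply/subvP; apply: krylov_ind => // [a u v uS vS|i u uS].
    by rewrite memvD ?memvZ.
  exact: sing_space_gaudin.
rewrite -(dimv_leqif_sup YS) eqn_leq dimvS //= leqNgt; apply/negP => YW.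
have [N N0 memN] := dot_complement YW.
pose fs := [seq gaudin m n (fun j => (z j)^*) i | i : 'I_l].
have [||v [/memN[vS Yv] v0 Ev]] := joint_eigenvector (fs := fs) N0.
- move=> _ /mapP[i _ ->]; apply/subvP => _ /memv_imgP[u /memN[uS Hu] ->].
  apply/memN; split=> [|y yY]; first exact: sing_space_gaudin.
  rewrite dotC -adjoint_gaudin -dotC Hu //.
  by apply: (subvP (Ht i)); apply: memv_img.
- by move=> _ _ /mapP[i _ ->] /mapP[j _ ->] u; apply: gaudinC.
have /fin_all_exists[c Hc] i : exists a, gaudin m n (fun j => (z j)^*) i v = a *: v.
  by apply: Ev; apply: map_f; rewrite mem_enum.
by have := Hw v c vS v0 Hc; rewrite Yv // eqxx.
Qed.

End Cyclic.

Lemma gaudin_alg_unital (K : fieldType) m n l (z : 'I_l -> K) :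
  unital_subalg (gaudin_alg m n z).
Proof.
split=> [B [[? ? ?] _] //|c f g fA gA B BH|f g fA gA B BH].
  by have [[_ BD _] _] := BH; apply: BD; [apply: fA | apply: gA].
by have [[_ _ BM] _] := BH; apply: BM; [apply: fA | apply: gA].
Qed.

Lemma gaudin_alg_gaudin (K : fieldType) m n l (z : 'I_l -> K) i :
  gaudin_alg m n z (gaudin m n z i).
Proof. by move=> B [_]; apply; exists i. Qed.

Theorem theorem5p10 (R : realType) (m n l : nat) (hn : (0 < n)%N)
  (hl : (1 < l)%N) (z : 'I_l -> R[i]) (hz : injective z) :
  exists w : tpow R[i] m n l,
    cyclic_vector (gaudin_alg m n z) (sing_space R[i] m n l) w.
Proof.
have [w wS [t SY]] := gaudin_cyclic m n hz.
have [A1 AD AM] := gaudin_alg_unital m n z.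
exists w; split=> //; apply/seteqP; split=> [_ [f fA <-]|v vS] /=.
  (* The operators preserving the singular space form a unital subalgebra containing the
     Hamiltonians. *)
  have := fA [set g : 'End(tpow R[i] m n l) | forall u,
    u \in sing_space R[i] m n l -> g u \in sing_space R[i] m n l]%classic.
  apply=> //; split; last by move=> _ [i _ <-] u; apply: sing_space_gaudin.
  split=> [u|c g h gS hS u uS|g h gS hS u uS] /=.
  - by rewrite id_lfunE.
  - by rewrite add_lfunE scale_lfunE memvD ?memvZ ?gS ?hS.
  - by rewrite comp_lfunE gS ?hS.
have /subvP/(_ v vS) vY := SY; move: v vY {vS}; apply: krylov_ind.
- by exists \1%VF => //; rewrite id_lfunE.
- move=> c _ _ [f fA <-] [g gA <-]; exists (c *: f + g); first exact: AD.
  by rewrite add_lfunE scale_lfunE.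
- move=> i _ [f fA <-]; exists (gaudin m n z i \o f)%VF; last by rewrite comp_lfunE.
  by apply: AM => //; apply: gaudin_alg_gaudin.
Qed.
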